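(* Let $\varphi\in\left(B_{\infty1}^1\right)_+$. Then for all contractions $T$ and $R$ on a Hilbert space the following formula holds: $$ \varphi(T)-\varphi(R)=\iint\limits_{\mathbb{T}\times\mathbb{T}}\frac{\varphi(\zeta)-\varphi(\tau)}{\zeta-\tau}\,d\mathcal{E}_T(\zeta)\,(T-R)\,d\mathcal{E}_R(\tau), $$ where $\mathcal{E}_T$ and $\mathcal{E}_R$ are semi-spectral measures of $T$ and $R$.
   Context: $\mathbb{D}$ is the open unit disk, $\mathbb{T}$ the unit circle. A contraction is an operator of norm at most $1$. $C_A$ is the disk-algebra (functions analytic in $\mathbb{D}$ and continuous on the closed disk). For $f\in C_A$ and a contraction $T$, $f(T)$ is defined by extending the polynomial calculus by continuity using von Neumann's inequality $\|f(T)\|\le\max_{|\zeta|\le1}|f(\zeta)|$. Besov class: let $w\ge0$ be the piecewise linear function on $\mathbb{R}$ supported in $[1/2,2]$, with $w(1)=1$ and linear on $[1/2,1]$ and on $[1,2]$. Put $W_n(z)=\sum_{k\in\mathbb{Z}}w(k/2^n)z^k$ for $n\ge1$, $W_0(z)=\bar z+1+z$, $W_n^\#=\overline{W_n}$. For $s>0$, $1\le p,q\le\infty$, $B^s_{pq}$ consists of functions $f$ on $\mathbb{T}$ with $\{2^{ns}\|f*W_n\|_{L^p}\}_{n\ge0}\in\ell^q$ and $\{2^{ns}\|f*W_n^\#\|_{L^p}\}_{n\ge1}\in\ell^q$. $\big(B^s_{pq}\big)_+$ is the set of $f\in B^s_{pq}$ with $\hat f(k)=0$ for $k<0$; such functions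 are identified with their analytic extensions to $\mathbb{D}$. Semi-spectral measures: for a measurable space $(\mathcal{X},\mathcal{B})$ and a Hilbert space $\mathcal{H}$, a semi-spectral measure is a map $\mathcal{E}$ from $\mathcal{B}$ to the bounded operators on $\mathcal{H}$ with $\mathcal{E}(\Delta)\ge0$, $\mathcal{E}(\varnothing)=0$, $\mathcal{E}(\mathcal{X})=I$, countably additive in the weak operator topology. By Naimark's theorem it has a spectral dilation, i.e., a spectral measure $E$ on a Hilbert space $\mathcal{K}\supset\mathcal{H}$ with $\mathcal{E}(\Delta)=P_{\mathcal{H}}E(\Delta)|\mathcal{H}$, and $\int f\,d\mathcal{E}:=P_{\mathcal{H}}\left(\int f\,dE\right)\big|\mathcal{H}$ for bounded measurable $f$ (independent of the dilation). A semi-spectral measure of a contraction $T$ on $\mathcal{H}$ is $\mathcal{E}_T(\Delta)=P_{\mathcal{H}}E_U(\Delta)|\mathcal{H}$, $\Delta\subset\mathbb{T}$ Borel, where $E_U$ is the spectral measure of a unitary dilation $U$ of $T$ (a unitary operator on some $\mathcal{K}\supset\mathcal{H}$ with $T^n=P_{\mathcal{H}}U^n|\mathcal{H}$, $n\ge0$); thus $T^n=\int_{\mathbb{T}}\zeta^n\,d\mathcal{E}_T(\zeta)$, $n\ge0$. Double operator integrals: if $\Phi(\zeta,\tau)=\sum_{n}f_n(\zeta)g_n(\tau)$ with $f_n,g_n\in C_A$ and $\sum_n\|f_n\|_\infty\|g_n\|_\infty<\infty$ (i.e. $\Phi$ belongs to the projective tensor product $C_A\hat\otimes C_A$), then for a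 bounded operator $Q$, $\iint\Phi\,d\mathcal{E}_T\,Q\,d\mathcal{E}_R:=\sum_n\left(\int f_n\,d\mathcal{E}_T\right)Q\left(\int g_n\,d\mathcal{E}_R\right)$, which does not depend on the representation. For $\varphi\in\big(B^1_{\infty1}\big)_+$ the divided difference $\frac{\varphi(\zeta)-\varphi(\tau)}{\zeta-\tau}$ (equal to $\varphi'(\zeta)$ when $\zeta=\tau$) is known to belong to $C_A\hat\otimes C_A$. *)

(* Defs.v *)
From HB Require Import structures.
From mathcomp Require Import all_boot all_order all_algebra.
From mathcomp Require Import complex sesquilinear.
From mathcomp Require Import all_classical all_reals all_analysis.

Set Implicit Arguments.
Unset Strict Implicit.
Unset Printing Implicit Defensive.

Import Order.TTheory GRing.Theory Num.Theory.
Import numFieldNormedType.Exports.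

Local Open Scope classical_set_scope.
Local Open Scope ring_scope.
Local Open Scope complex_scope.

(* [R[i]] carries the topology of its norm [`|z|]. *)
HB.instance Definition _ (R : realType) := NormedModule.copy R[i] R[i]^o.

(* The form [ip] is linear in its first argument and conjugate-linear in the
   second. *)
HB.mixin Record CompleteNormedModule_isHilbert (R : realType) H
    of CompleteNormedModule R[i] H := {
  ip : {dot H for @Num.conj R[i]} ;
  ip_norm : forall x : H, ip x x = `|x| ^+ 2
}.

#[short(type="hilbertType")]
HB.structure Definition Hilbert (R : realType) :=
  {H of CompleteNormedModule R[i] H & CompleteNormedModule_isHilbert R H}.

Section Operators.
Context {R : realType}.
Implicit Types H K : hilbertType R.

Definition contraction_op H (T : {linear H -> H}) : Prop :=
  forall x, `|T x| <= `|x|.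

Definition isometric_op H K (V : {linear H -> K}) : Prop :=
  forall x, `|V x| = `|x|.

Definition unitary_op K (U : {linear K -> K}) : Prop :=
  isometric_op U /\ forall y, exists x, U x = y.

(* Convergence in the operator norm: [A n - B] is eventually of norm at most
   [e]. A positive element of [R[i]] is a positive real number. *)
Definition op_cvg H (A : nat -> H -> H) (B : H -> H) : Prop :=
  forall e : R[i], 0 < e ->
    \forall n \near \oo, forall x, `|A n x - B x| <= e * `|x|.

(* An inclusion of Hilbert spaces is rendered by an isometry [V : H -> K].
   [compression V A B] says that [B = P_H A | H], i.e. that [V (B x)] is the
   orthogonal projection of [A (V x)] onto the range of [V]. *)
Definition compression H K (V : {linear H -> K}) (A : K -> K) (B : H -> H) :
    Prop :=
  forall x y, ip (A (V x) - V (B x)) (V y) = 0.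

End Operators.

Section SemiSpectral.
Context {R : realType} d (X : measurableType d).
Implicit Types H K : hilbertType R.

(* The values on non-measurable sets are irrelevant. *)
Record semi_spectral H (E : set X -> {linear H -> H}) : Prop := SemiSpectral {
  semi_spectral_bounded : forall D, measurable D -> continuous (E D) ;
  semi_spectral_ge0 : forall D, measurable D -> forall x, 0 <= ip (E D x) x ;
  semi_spectral0 : forall x, E set0 x = 0 ;
  semi_spectralT : forall x, E setT x = x ;
  semi_spectral_sigma_additive : forall D : (set X)^nat,
    (forall n, measurable (D n)) -> trivIset setT D ->
    forall x y, series (fun n => ip (E (D n) x) y) @ \oo -->
                ip (E (\bigcup_n D n) x) y
}.

(* A positive idempotent is an orthogonal projection. *)
Definition spectral H (E : set X -> {linear H -> H}) : Prop :=
  semi_spectral E /\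
  forall D, measurable D -> forall x, E D (E D x) = E D x.

Definition simple_fun (s : X -> R[i]) : Prop :=
  finite_set (range s) /\ forall c, measurable (s @^-1` [set c]).

Definition simple_integral H (E : set X -> {linear H -> H}) (s : X -> R[i]) :
    H -> H :=
  fun x => \sum_(c \in range s) c *: E (s @^-1` [set c]) x.

(* [A] is the integral of [f] against the spectral measure [E]; the uniform
   limits of simple functions are the bounded measurable functions. *)
Definition is_spectral_integral H (E : set X -> {linear H -> H})
    (f : X -> R[i]) (A : H -> H) : Prop :=
  exists s : nat -> X -> R[i],
    [/\ forall n, simple_fun (s n),
        {uniform, s @ \oo --> f} &
        op_cvg (fun n => simple_integral E (s n)) A].

Definition spectral_dilation H (E : set X -> {linear H -> H})
    K (V : {linear H -> K}) (F : set X -> {linear K -> K}) : Prop :=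
  [/\ isometric_op V, spectral F &
      forall D, measurable D -> compression V (F D) (E D)].

Definition is_semi_spectral_integral H (E : set X -> {linear H -> H})
    (f : X -> R[i]) (A : H -> H) : Prop :=
  exists (K : hilbertType R) (V : {linear H -> K})
         (F : set X -> {linear K -> K}) (B : K -> K),
    [/\ spectral_dilation E V F,
        is_spectral_integral F f B &
        compression V B A].

(* The integral does not depend on the dilation, so [xget] selects the only
   candidate; the default value 0 is taken only when there is none. The same
   remark applies to [disk_calculus] and [double_operator_integral] below. *)
Definition semi_spectral_integral H (E : set X -> {linear H -> H})
    (f : X -> R[i]) : H -> H :=
  xget (fun=> 0) [set A | is_semi_spectral_integral E f A].

End SemiSpectral.

Section Circle.
Variable R : realType.

Definition closed_disk : set R[i] := [set z | `|z| <= 1].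

Definition circle : Type := {z : R[i] | `|z| == 1}.

Lemma norm_expi (t : R) : `|cos t +i* sin t| == 1.
Proof. by rewrite normc_def /= cos2Dsin2 sqrtr1. Qed.

Definition expi (t : R) : circle := exist _ (cos t +i* sin t) (norm_expi t).

HB.instance Definition _ := Choice.on circle.
HB.instance Definition _ := isPointed.Build circle (expi 0).

(* The Borel sets of the circle, as a subspace of [R[i]]. *)
Definition circle_open : set (set circle) :=
  [set A | exists2 U : set R[i], open U & A = sval @^-1` U].

Definition circle_borel := g_sigma_algebraType circle_open.

Lemma pi2_gt0 : 0 < pi *+ 2 :> R.
Proof. by rewrite mulrn_wgt0 ?pi_gt0. Qed.

(* The law of the angle under the normalized Lebesgue measure of the circle. *)
Definition angle_measure : probability (measurableTypeR R) R :=
  uniform_prob pi2_gt0.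

Definition circle_integrable (g : circle -> R[i]) : Prop :=
  angle_measure.-integrable setT (fun t => (complex.Re (g (expi t)))%:E) /\
  angle_measure.-integrable setT (fun t => (complex.Im (g (expi t)))%:E).

Definition circle_integral (g : circle -> R[i]) : R[i] :=
  (\int[angle_measure]_t complex.Re (g (expi t))) +i*
  (\int[angle_measure]_t complex.Im (g (expi t))).

Definition circle_Lnorm (p : \bar R) (g : circle -> R[i]) : \bar R :=
  Lnorm angle_measure p (fun t => (complex.Re `|g (expi t)|)%:E).

Definition fourier (g : circle -> R[i]) (k : int) : R[i] :=
  circle_integral (fun z => g z * sval z ^ (- k)).

Definition circle_conv (g : circle -> R[i]) (W : R[i] -> R[i]) :
    circle -> R[i] :=
  fun z => circle_integral (fun w => g w * W (sval z * (sval w)^-1)).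

End Circle.

Arguments closed_disk R : clear implicits.

Section Besov.
Variable R : realType.

Definition besov_w (x : R) : R :=
  if (2^-1 <= x <= 1) then 2 * x - 1
  else if (1 <= x <= 2) then 2 - x
  else 0.

Definition besov_W (n : nat) (z : R[i]) : R[i] :=
  if n is 0%N then z^*%C + 1 + z
  else \sum_(k \in [set: int]) (besov_w (k%:~R / 2 ^+ n))%:C * z ^ k.

Definition besov_Wsharp (n : nat) (z : R[i]) : R[i] := (besov_W n z)^*%C.

Definition besov (s : R) (p q : \bar R) : set (circle R -> R[i]) :=
  [set f | [/\ circle_integrable f,
    (Lnorm counting q (fun n : nat =>
       (2 `^ (n%:R * s))%:E * circle_Lnorm p (circle_conv f (besov_W n)))
      < +oo)%E &
    (Lnorm counting q (fun n : nat =>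
       (2 `^ (n.+1%:R * s))%:E *
       circle_Lnorm p (circle_conv f (besov_Wsharp n.+1)))
      < +oo)%E]].

Definition besov_plus (s : R) (p q : \bar R) : set (circle R -> R[i]) :=
  [set f | besov s p q f /\ forall k : int, k < 0 -> fourier f k = 0].

(* The power series of the analytic extension of [f] to the open disk. Under
   [besov_plus 1 +oo 1] it converges absolutely on the closed disk, and on the
   circle its sum is the continuous function equal to [f] almost everywhere. *)
Definition analytic_extension (f : circle R -> R[i]) (z : R[i]) : R[i] :=
  limn (series (fun k : nat => fourier f k%:Z * z ^+ k)).

End Besov.

Section DiskAlgebra.
Context {R : realType}.
Implicit Types H : hilbertType R.

Definition disk_algebra (f : R[i] -> R[i]) : Prop :=
  {within closed_disk R, continuous f} /\
  forall z, `|z| < 1 -> derivable f z 1.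

Definition disk_norm (f : R[i] -> R[i]) : R :=
  sup [set complex.Re `|f z| | z in closed_disk R].

Definition poly_calculus H (p : {poly R[i]}) (T : H -> H) : H -> H :=
  fun x => \sum_(i < size p) p`_i *: iter i T x.

Definition is_disk_calculus H (f : R[i] -> R[i]) (T A : H -> H) : Prop :=
  exists p : nat -> {poly R[i]},
    {uniform closed_disk R, (fun n z => (p n).[z]) @ \oo --> f} /\
    op_cvg (fun n => poly_calculus (p n) T) A.

(* Extension of the polynomial calculus by continuity: polynomials are dense in
   the disk-algebra, and the limit is unique by von Neumann's inequality. *)
Definition disk_calculus H (f : R[i] -> R[i]) (T : H -> H) : H -> H :=
  xget (fun=> 0) [set A | is_disk_calculus f T A].

(* On the diagonal, the derivative at a boundary point, taken within the
   closed disk. *)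
Definition divided_difference (f : R[i] -> R[i]) (z w : circle R) : R[i] :=
  if sval z == sval w then
    lim ((f u - f (sval z)) / (u - sval z)
           @[u --> within (closed_disk R) (sval z)^'])
  else (f (sval z) - f (sval w)) / (sval z - sval w).

End DiskAlgebra.

Section DoubleOperatorIntegral.
Context {R : realType} (H : hilbertType R).

(* [is_spectral_integral F sval U] says that [U] is the integral of [zeta]
   against [F], i.e. that [F] is the spectral measure of [U]. *)
Definition semi_spectral_measure_of (T : {linear H -> H})
    (E : set (circle_borel R) -> {linear H -> H}) : Prop :=
  exists (K : hilbertType R) (V : {linear H -> K}) (U : {linear K -> K})
         (F : set (circle_borel R) -> {linear K -> K}),
    [/\ unitary_op U,
        forall n : nat, compression V (iter n U) (iter n T),
        is_spectral_integral F sval U &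
        spectral_dilation E V F].

Definition tensor_representation (Phi : circle R -> circle R -> R[i])
    (f g : nat -> R[i] -> R[i]) : Prop :=
  [/\ forall n, disk_algebra (f n),
      forall n, disk_algebra (g n),
      (\sum_(0 <= n <oo) (disk_norm (f n) * disk_norm (g n))%:E < +oo)%E &
      forall z w, series (fun n => f n (sval z) * g n (sval w)) @ \oo -->
                  Phi z w].

Definition is_double_operator_integral (Phi : circle R -> circle R -> R[i])
    (E1 : set (circle_borel R) -> {linear H -> H}) (Q : H -> H)
    (E2 : set (circle_borel R) -> {linear H -> H}) (A : H -> H) : Prop :=
  exists f g : nat -> R[i] -> R[i],
    tensor_representation Phi f g /\
    op_cvg (fun N x => \sum_(0 <= n < N)
      semi_spectral_integral E1 (f n \o sval)
        (Q (semi_spectral_integral E2 (g n \o sval) x))) A.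

Definition double_operator_integral (Phi : circle R -> circle R -> R[i])
    (E1 : set (circle_borel R) -> {linear H -> H}) (Q : H -> H)
    (E2 : set (circle_borel R) -> {linear H -> H}) : H -> H :=
  xget (fun=> 0) [set A | is_double_operator_integral Phi E1 Q E2 A].

End DoubleOperatorIntegral.

(* Main.v *)
(* A semi-spectral integral of a uniform limit of simple functions is the norm
   limit of finite sums, so the double operator integral of a tensor
   representation is approximated by the sums of
   Phi(z_i, w_j) E_T(D_i) (T - S) E_S(D_j) over fine partitions of the circle.
   These depend on Phi only, hence so does the integral, and it is enough to
   evaluate it on one representation of the divided difference.

   For a Besov block P = sum_m b_m z^m with spectrum in ]N, 4N[ the divided
   difference is sum_(j, k) b_(j+k+1) z^j w^k. It is split by a partition of unity
   alpha(j, k) + alpha(k, j) = 1, where alpha is a piecewise linear function of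
   j - k vanishing for j - k <= - N. For fixed k the j-sum is then, up to a power
   of z, the result of a trapezoidal Fourier multiplier applied to P, hence
   bounded by 2 ||P||; so the projective norm is O(N ||P||), which is summable.
   On the resulting tensors z^j w^k the formula is the telescoping identity
   sum_(j, k) b_(j+k+1) T^j (T - S) S^k = P(T) - P(S). *)
Require Import Defs.
From HB Require Import structures.
From mathcomp Require Import all_boot all_order all_algebra.
From mathcomp Require Import complex sesquilinear finmap.
From mathcomp Require Import cyclic separable cyclotomic.
From mathcomp Require Import all_classical all_reals all_analysis.
From mathcomp Require Import ess_sup_inf measurable_realfun.
From mathcomp Require Import ring lra zify.
Set Implicit Arguments.
Unset Strict Implicit.
Unset Printing Implicit Defensive.
Import Order.TTheory GRing.Theory Num.Theory.
Import numFieldNormedType.Exports.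
Local Open Scope classical_set_scope.
Local Open Scope ring_scope.
Local Open Scope complex_scope.

(** The projective norm forces the gradual splitting. Expanding a block P into monomials costs sum_m
    m |b_m|, in general not O(N ||P||). Grouping by powers of w leaves only O(N) tensors but
    truncates P, and a sharp truncation may cost a factor log N that the condition sum_n 2^n ||f *
    W_n|| < oo does not absorb. The ramp alpha avoids this: as P has no coefficient of index at most
    N, alpha has already reached zero where j would become negative, so no jump remains.

    The integrals and calculi in the statement are values picked by [xget], and each candidate comes
    with its own dilation or its own polynomials. They are compared through [uniform_integral],
    which mentions the measure E alone. The bound 2 sup |u| for such integrals, obtained by
    polarization, also does the work of von Neumann's inequality; the factor 2 is harmless because
    only convergence is at stake.

    Polynomials are averaged over roots of unity of large order. These averages are finite sums and
    exact, and they yield both the maximum principle and the multiplier bound. *)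

(** * Hilbert space preliminaries *)

Section HilbertFacts.
Variables (R : realType).
Implicit Types H K : hilbertType R.

(* A plain function, on which rewriting does not have to infer the form. *)
Definition inner H (x y : H) : R[i] := ip x y.

Lemma innerxx H (x : H) : inner x x = `|x| ^+ 2.
Proof. exact: ip_norm. Qed.

Lemma innerDl H (x y z : H) : inner (x + y) z = inner x z + inner y z.
Proof. exact: linearDl. Qed.

Lemma innerDr H (x y z : H) : inner x (y + z) = inner x y + inner x z.
Proof. exact: linearDr. Qed.

Lemma innerZl H a (x y : H) : inner (a *: x) y = a * inner x y.
Proof. exact: linearZl_LR. Qed.

Lemma innerZr H a (x y : H) : inner x (a *: y) = a^*%R * inner x y.
Proof. exact: linearZr. Qed.

Lemma inner0l H (y : H) : inner 0 y = 0.
Proof. exact: linear0l. Qed.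

Lemma innerNl H (x y : H) : inner (- x) y = - inner x y.
Proof. exact: linearNl. Qed.

Lemma innerBl H (x y z : H) : inner (x - y) z = inner x z - inner y z.
Proof. by rewrite innerDl innerNl. Qed.

Lemma innerC H (x y : H) : inner x y = (inner y x)^*%R.
Proof. by have := @hermC _ _ _ _ (@ip R H) x y; rewrite mul1r. Qed.

Lemma inner_suml H (I : Type) (s : seq I) (v : I -> H) y :
  inner (\sum_(i <- s) v i) y = \sum_(i <- s) inner (v i) y.
Proof.
by elim: s => [|i s ih]; rewrite ?big_nil ?inner0l // !big_cons innerDl ih.
Qed.

Lemma inner_eq0 H (x : H) : (inner x x == 0) = (x == 0).
Proof. by rewrite innerxx sqrf_eq0 normr_eq0. Qed.

Lemma inner_injl H (x x' : H) : (forall y, inner x y = inner x' y) -> x = x'.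
Proof.
move=> h; apply/eqP; rewrite -subr_eq0 -inner_eq0 innerBl.
by rewrite h subrr.
Qed.

(** The residual [A (V x) - V (B x)] is orthogonal to [V (B x)], so this is Pythagoras. *)
Lemma compression_le H K (V : {linear H -> K}) (A : K -> K) (B : H -> H) x :
  isometric_op V -> compression V A B -> `|B x| <= `|A (V x)|.
Proof.
move=> iV cAB; rewrite -(iV (B x)).
have : inner (A (V x) - V (B x)) (V (B x)) = 0 by exact: cAB.
have -> : A (V x) = (A (V x) - V (B x)) + V (B x) by rewrite subrK.
move: (V (B x)) => v; rewrite addrK; move: (A (V x) - v) => w wv.
rewrite -(@ler_sqr _ `|v|) ?nnegrE // -!innerxx innerDl !innerDr. rewrite wv.
by rewrite (innerC v w) wv conjC0 addr0 add0r lerDr innerxx exprn_ge0.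
Qed.

Lemma compression_unique H K (V : {linear H -> K}) (A : K -> K) (B C : H -> H) :
  isometric_op V -> compression V A B -> compression V A C -> B =1 C.
Proof.
move=> iV cB cC x; apply/eqP; rewrite -subr_eq0 -normr_eq0 -iV normr_eq0.
rewrite -inner_eq0; set y := B x - C x.
have := cB x y; have := cC x y; rewrite -/(inner _ _) -/(inner _ _) !innerBl.
move=> /eqP; rewrite subr_eq0 => /eqP -> /eqP; rewrite subr_eq0 => /eqP e.
have -> : V y = V (B x) - V (C x) by rewrite linearB.
by rewrite innerBl; move: e; rewrite /y linearB => ->; rewrite subrr.
Qed.

Lemma compressionD H K (V : {linear H -> K}) A B A' B' :
  compression V A B -> compression V A' B' ->
  compression V (fun x => A x + A' x) (fun x => B x + B' x).
Proof.
move=> c c' x y; rewrite -/(inner _ _).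
have e : inner (A (V x) - V (B x)) (V y) = 0 by exact: c.
have e' : inner (A' (V x) - V (B' x)) (V y) = 0 by exact: c'.
by rewrite linearD opprD addrACA innerDl e e' addr0.
Qed.

Lemma compressionZ H K (V : {linear H -> K}) A B (a : R[i]) :
  compression V A B -> compression V (fun x => a *: A x) (fun x => a *: B x).
Proof.
move=> c x y; rewrite -/(inner _ _) linearZ /= -scalerBr innerZl.
have e : inner (A (V x) - V (B x)) (V y) = 0 by exact: c.
by rewrite e mulr0.
Qed.

Lemma compression0 H K (V : {linear H -> K}) :
  compression V (fun=> 0) (fun=> 0).
Proof. by move=> x y; rewrite -/(inner _ _) linear0 subrr inner0l. Qed.

Lemma compression_sum H K (V : {linear H -> K}) (I : Type) (s : seq I)
    (c : I -> R[i]) A B :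
  (forall i, compression V (A i) (B i)) ->
  compression V (fun x => \sum_(i <- s) c i *: A i x)
                (fun x => \sum_(i <- s) c i *: B i x).
Proof.
move=> cAB; elim: s => [|i s ih].
  move=> x y; rewrite !big_nil; exact: (@compression0 _ _ V x y).
move=> x y; rewrite !big_cons.
exact: (compressionD (compressionZ (c i) (cAB i)) ih x y).
Qed.

(* Polarization; the form [inner (P x) y] need not be known to be hermitian. *)
Lemma polarization_le H (P : {linear H -> H}) (x y : H) :
  (forall z, 0 <= inner (P z) z) ->
  `|inner (P x) y| <= inner (P x) x + inner (P y) y.
Proof.
move=> P0.
pose g (a : R[i]) := inner (P (x + a *: y)) (x + a *: y).
have gE a : `|a| = 1 -> g a = inner (P x) x + inner (P y) y +
     (a^*%R * inner (P x) y + a * inner (P y) x).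
  move=> a1; rewrite /g linearD linearZ /= !innerDl !innerZl !innerDr !innerZr.
  have aa : a * a^*%R = 1 by rewrite -normCK a1 expr1n.
  by ring: aa.
have ni : `|'i%R| = 1 :> R[i] by rewrite normCi.
have ci : ('i%R : R[i])^*%R = - 'i%R by exact: conjCi.
have c1 : (1 : R[i])^*%R = 1 by exact: rmorph1.
have cm1 : (- 1 : R[i])^*%R = - 1 by rewrite rmorphN /= c1.
have cmi : (- 'i%R : R[i])^*%R = 'i%R by rewrite rmorphN /= ci opprK.
have cE := (c1, cm1, ci, cmi).
have ii : 'i%R * 'i%R = - 1 :> R[i] by rewrite -expr2 sqrCi.
(* Polarization identity. Every [g a] is nonnegative, so bounding term by term gives the plain sum
   of the four values, in which the cross terms cancel. *)
have e4 : inner (P x) y *+ 4 = g 1 - g (-1) + 'i%R * (g 'i%R - g (- 'i%R)).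
  by rewrite !gE ?normrN ?normr1 // !cE; ring: ii.
have nx : `|inner (P x) y *+ 4| <= g 1 + g (-1) + (g 'i%R + g (- 'i%R)).
  rewrite e4; apply: (le_trans (ler_normD _ _)); apply: lerD.
    by apply: (le_trans (ler_normB _ _)); rewrite !ger0_norm ?P0.
  rewrite normrM ni mul1r.
  by apply: (le_trans (ler_normB _ _)); rewrite !ger0_norm ?P0.
move: nx; rewrite normrMn !gE ?normrN ?normr1 // !cE.
set u := inner _ x; set v := inner _ y; set a := inner _ y; set b := inner _ x.
rewrite [X in _ <= X](_ : _ = (u + a) *+ 4); last by ring.
by rewrite lerMn2r.
Qed.
End HilbertFacts.

(** * Finite additivity and orthogonality of spectral measures *)

Section FiniteAdditivity.
Context {R : realType} d {X : measurableType d}.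
Implicit Types H K : hilbertType R.

(** Countable additivity for the sequence A, B, empty, empty, ..., whose series is constant from
    index 2 on. *)
Lemma semi_spectralU H (E : set X -> {linear H -> H}) A B x :
  semi_spectral E -> measurable A -> measurable B -> A `&` B = set0 ->
  E (A `|` B) x = E A x + E B x.
Proof.
move=> sE mA mB AB; apply: inner_injl => y; rewrite innerDl.
have := semi_spectral_sigma_additive sE (D := bigcup2 A B).
have mD n : measurable (bigcup2 A B n) by case: n => [|[|n]] //=.
have tD : trivIset setT (bigcup2 A B).
  by rewrite -trivIset_bigcup2.
move=> /(_ mD tD x y); rewrite bigcup2E => cv.
have c0 : series (fun n => inner (E (bigcup2 A B n) x) y) @ \oo
    --> inner (E A x) y + inner (E B x) y.
  apply: cvg_near_cst; near=> n.
  have n2 : (2 <= n)%N by near: n; exact: nbhs_infty_ge.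
  rewrite seriesEnat /= (big_cat_nat _ n2) //= big_nat_recr //= big_nat1 /=.
  rewrite big_nat_cond big1 ?addr0 // => -[|[|i]] //=.
  by rewrite semi_spectral0 // inner0l.
exact: (cvg_unique _ cv c0).
Unshelve. all: by end_near. Qed.

(** Idempotence of F(A u B) = F(A) + F(B) makes F(A) and F(B) anticommute. Multiplying by F(A) on
    the left and on the right shows that they also commute, so 2 F(A) F(B) = 0. *)
Lemma spectral_disjoint H (F : set X -> {linear H -> H}) A B x :
  spectral F -> measurable A -> measurable B -> A `&` B = set0 ->
  F A (F B x) = 0.
Proof.
move=> [sF idF] mA mB AB.
have anti z : F A (F B z) + F B (F A z) = 0.
  have := idF _ (measurableU _ _ mA mB) z.
  rewrite !(semi_spectralU _ sF mA mB AB) !linearD /= !idF //.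
  rewrite [F B (F A z) + _]addrC addrACA -[RHS]addr0.
  exact: addrI.
have e1 := anti (F A x); rewrite idF // in e1.
have e2 : F A (F B x) + F A (F B (F A x)) = 0.
  by rewrite -{1}(idF _ mA (F B x)) -linearD anti linear0.
have e : F A (F B x) = F B (F A x).
  apply/eqP; rewrite -subr_eq0 -[X in X - _](addrK (F A (F B (F A x)))).
  by rewrite e2 add0r -opprD e1 oppr0.
have := anti x; rewrite -e -mulr2n => /eqP.
by rewrite -scaler_nat scaler_eq0 pnatr_eq0 /= => /eqP.
Qed.

Section Partition.
Variables (I : finType) (r : X -> I).
Hypothesis mr : forall i, measurable (r @^-1` [set i]).

Lemma semi_spectral_fibres H (E : set X -> {linear H -> H}) (s : seq I) x :
  semi_spectral E -> uniq s ->
  E (r @^-1` [set` s]) x = \sum_(i <- s) E (r @^-1` [set i]) x.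
Proof.
move=> sE; elim: s => [|i s ih] /=.
  rewrite (_ : [set` [::]] = set0) ?preimage_set0 ?big_nil; last first.
    by rewrite -subset0.
  by move=> _; exact: semi_spectral0.
move=> /andP[si us]; rewrite big_cons -ih //.
  rewrite (_ : [set` i :: s] = [set i] `|` [set` s]); last first.
    by apply/seteqP; split => j /=; rewrite inE => /predU1P.
  rewrite preimage_setU.
apply: semi_spectralU => //.
  rewrite [X in measurable X](_ : _ = \bigcup_(j in [set` s]) r @^-1` [set j]).
    by apply: fin_bigcup_measurable => // j _; exact: mr.
  by apply/seteqP; split => t /=; [move=> h; exists (r t)|case=> j js ->].
by rewrite -subset0 => t [/= -> ]; rewrite (negbTE si).
Qed.

(** Unlike in [simple_integral], coefficients may repeat and fibres may be empty. Two simple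
    functions can thus be written over one partition and combined coefficientwise. *)
Definition partition_integral H (E : set X -> {linear H -> H}) (c : I -> R[i])
    (x : H) : H :=
  \sum_i c i *: E (r @^-1` [set i]) x.

Lemma simple_integral_partition H (E : set X -> {linear H -> H}) c x :
  semi_spectral E ->
  simple_integral E (c \o r) x = partition_integral E c x.
Proof.
move=> sE; rewrite /simple_integral /partition_integral.
have fib v : (c \o r) @^-1` [set v] =
    r @^-1` [set` [seq i <- index_enum I | c i == v]].
  apply/seteqP; split => t /=; rewrite mem_filter mem_index_enum andbT.
    by move=> ->.
  by move=> /eqP.
have Ev v : E ((c \o r) @^-1` [set v]) x =
    \sum_(i | c i == v) E (r @^-1` [set i]) x.
  by rewrite fib semi_spectral_fibres ?filter_uniq ?index_enum_uniq // big_filter.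
pose s := undup [seq c i | i <- index_enum I].
rewrite (fsbig_widen (range (c \o r)) [set` s]); first last.
- move=> v [_ /= nv]; rewrite [_ @^-1` _](_ : _ = set0); last first.
    by rewrite -subset0 => t /= tv; apply: nv; exists t.
  by rewrite semi_spectral0 // scaler0.
- by move=> v [t _ <-]; rewrite /= mem_undup map_f ?mem_index_enum.
rewrite -fsbig_seq ?undup_uniq //.
under eq_bigr do rewrite Ev scaler_sumr.
rewrite (exchange_big_dep xpredT) //=; apply: eq_bigr => i _.
rewrite big_mkcond (bigD1_seq (c i)) ?undup_uniq //=; last first.
  by rewrite mem_undup map_f ?mem_index_enum.
by rewrite eqxx big1 ?addr0 // => v; rewrite eq_sym => /negbTE ->.
Qed.

Lemma semi_spectral_sum_fibres H (E : set X -> {linear H -> H}) x :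
  semi_spectral E -> \sum_i E (r @^-1` [set i]) x = x.
Proof.
move=> sE; rewrite -semi_spectral_fibres ?index_enum_uniq //.
rewrite (_ : r @^-1` _ = setT) ?semi_spectralT //.
by apply/seteqP; split => t //= _; rewrite mem_index_enum.
Qed.

(** Polarization on each fibre, applied to x and t y with t = 1 / (2 M), bounds |y|^2 by 2 M^2 |x|^2
    + |y|^2 / 2; this t lets half of |y|^2 be absorbed on the left. *)
Lemma partition_integral_le H (E : set X -> {linear H -> H}) c (M : R[i]) x :
  semi_spectral E -> 0 < M -> (forall t, `|c (r t)| <= M) ->
  `|partition_integral E c x| <= 2 * M * `|x|.
Proof.
move=> sE M0 cM; set y := partition_integral E c x.
have E0 i z : 0 <= inner (E (r @^-1` [set i]) z) z.
  by apply: semi_spectral_ge0.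
have sumE z : \sum_i inner (E (r @^-1` [set i]) z) z = `|z| ^+ 2.
  by rewrite -innerxx -{3}(semi_spectral_sum_fibres z sE) inner_suml.
pose t : R[i] := (2 * M)^-1.
have t0 : 0 < t by rewrite invr_gt0 mulr_gt0.
have le i : `|inner (c i *: E (r @^-1` [set i]) x) y| <=
    M * (t^-1 * (inner (E (r @^-1` [set i]) x) x +
                 t ^+ 2 * inner (E (r @^-1` [set i]) y) y)).
  (* The coefficients are bounded only on the range of [r]; an empty fibre contributes zero whatever
     its coefficient. *)
  have [[u ui]|no] := pselect (exists u, r u = i); last first.
    have -> : r @^-1` [set i] = set0.
      by rewrite -subset0 => u /= ui; apply: no; exists u.
    by rewrite !semi_spectral0 // scaler0 !inner0l normr0 mulr0 addr0 !mulr0.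
  rewrite innerZl normrM -ui ler_pM // ui.
  have := polarization_le x (t *: y) (E0 i).
  rewrite linearZ /= !innerZr innerZl (CrealP (gtr0_real t0)) normrM.
  rewrite (gtr0_norm t0) mulrA -expr2 => h.
  by rewrite ler_pdivlMl.
have : `|y| ^+ 2 <= (2 * M) ^+ 2 / 2 * `|x| ^+ 2 + `|y| ^+ 2 / 2.
  rewrite -[X in X <= _]innerxx {1}/y /partition_integral inner_suml.
  rewrite -[X in X <= _]ger0_norm; last first.
    by rewrite -inner_suml -/(partition_integral E c x) innerxx exprn_ge0.
  apply: (le_trans (ler_norm_sum _ _ _)).
  apply: (le_trans (ler_sum _ (fun i _ => le i))).
  rewrite -!mulr_sumr big_split /= -mulr_sumr !sumE /t invrK.
  rewrite le_eqVlt; apply/orP; left; apply/eqP.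
  by field; rewrite gt_eqF.
rewrite -lerBlDr -{1}[ `|y| ^+ 2]mulr1 -mulrBr => h.
rewrite -(@ler_sqr _ `|y|) ?nnegrE ?mulr_ge0 // ?(ltW M0) // exprMn.
rewrite -(@ler_pM2r _ (1 - 2^-1)); last by rewrite subr_gt0 invf_lt1 ?ltr1n.
apply: (le_trans h); rewrite le_eqVlt; apply/orP; left; apply/eqP.
by field.
Qed.

Lemma partition_integralM H (F : set X -> {linear H -> H}) c c' x :
  spectral F ->
  partition_integral F c (partition_integral F c' x) =
  partition_integral F (fun i => c i * c' i) x.
Proof.
move=> sF; rewrite /partition_integral; apply: eq_bigr => i _.
rewrite linear_sum (bigD1 i) //= big1 ?addr0.
  by rewrite linearZ /= (sF.2 _ (mr i)) scalerA.
move=> j ji; rewrite linearZ /= spectral_disjoint ?scaler0 //.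
by rewrite -subset0 => t [/= -> e]; rewrite e eqxx in ji.
Qed.

End Partition.

Lemma simple_fun2_partition (s1 s2 : X -> R[i]) :
  simple_fun s1 -> simple_fun s2 ->
  exists (I : finType) (r : X -> I) (c1 c2 : I -> R[i]),
    [/\ forall i, measurable (r @^-1` [set i]), s1 = c1 \o r & s2 = c2 \o r].
Proof.
move=> [f1 m1] [f2 m2].
have h1 t : s1 t \in fset_set (range s1) by rewrite in_fset_set // inE; exists t.
have h2 t : s2 t \in fset_set (range s2) by rewrite in_fset_set // inE; exists t.
pose r t : (fset_set (range s1) * fset_set (range s2))%type :=
  ([` h1 t]%fset, [` h2 t]%fset).
exists _, r, (fun i => val i.1), (fun i => val i.2); split => //.
move=> [i1 i2].
rewrite (_ : r @^-1` _ = s1 @^-1` [set val i1] `&` s2 @^-1` [set val i2]).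
  exact: measurableI.
apply/seteqP; split => t /=.
  by move=> [<- <-].
by move=> [e1 e2]; rewrite /r; congr pair; apply: val_inj.
Qed.

End FiniteAdditivity.

(** * Integrals of simple functions: bounds, compression and algebra *)

Section Integral.
Context {R : realType} d {X : measurableType d}.
Implicit Types H K : hilbertType R.

(** Isolated as a property because [spectral_dilation] does not state that [E] is semi-spectral: the
    bound is proved for the dilation and passes to [E] by compression. *)
Definition bounded_integral H (E : set X -> {linear H -> H}) : Prop :=
  forall s s' (M : R[i]), simple_fun s -> simple_fun s' -> 0 < M ->
    (forall t, `|s t - s' t| <= M) ->
    forall x, `|simple_integral E s x - simple_integral E s' x| <= 2 * M * `|x|.

Lemma semi_spectral_bounded_integral H (E : set X -> {linear H -> H}) :
  semi_spectral E -> bounded_integral E.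
Proof.
move=> sE s s' M ss ss' M0 le x.
have [I [r [c [c' [mr e e']]]]] := simple_fun2_partition ss ss'.
rewrite {}e {}e' in le *.
rewrite !(simple_integral_partition mr) // -sumrB.
under eq_bigr do rewrite -scalerBl.
exact: (partition_integral_le mr (c := fun i => c i - c' i)).
Qed.

Lemma simple_integral_compression H K
    (E : set X -> {linear H -> H}) (V : {linear H -> K}) F s :
  spectral_dilation E V F -> simple_fun s ->
  compression V (simple_integral F s) (simple_integral E s).
Proof.
move=> [iV sF cV] [fs ms]; rewrite /simple_integral => x y.
rewrite !fsbig_finite //=.
have h : compression V
    (fun x => \sum_(i <- fset_set (range s) | true) i *: F (s @^-1` [set i]) x)
    (fun x => \sum_(i <- fset_set (range s) | true) i *: E (s @^-1` [set i]) x).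
  by apply: compression_sum => i; exact: cV.
exact: (h x y).
Qed.

Lemma dilation_bounded_integral H K
    (E : set X -> {linear H -> H}) (V : {linear H -> K}) F :
  spectral_dilation E V F -> bounded_integral E.
Proof.
move=> dil s s' M ss ss' M0 le x; have [iV [sF _] _] := dil.
have cs := simple_integral_compression dil ss.
have cs' := compressionZ (-1) (simple_integral_compression dil ss').
have := compression_le x iV (compressionD cs cs').
rewrite !scaleN1r => /le_trans; apply.
rewrite -[X in _ <= _ * X]iV.
exact: (semi_spectral_bounded_integral sF).
Qed.

(** Regrouping fibres needs additivity, which is available for [F]; the identity is proved there and
    compressed to [E]. *)
Lemma simple_integral_partition_dilation H K
    (E : set X -> {linear H -> H}) (V : {linear H -> K}) F
    (I : finType) (r : X -> I) c x :
  spectral_dilation E V F -> (forall i, measurable (r @^-1` [set i])) ->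
  simple_fun (c \o r) ->
  simple_integral E (c \o r) x = partition_integral r E c x.
Proof.
move=> dil mr sc; have [iV [sF _] cV] := dil.
apply: (compression_unique iV (simple_integral_compression dil sc)).
move=> {}x y; rewrite simple_integral_partition //.
have h : compression V
   (fun x => \sum_(i <- index_enum I) c i *: F (r @^-1` [set i]) x)
   (fun x => \sum_(i <- index_enum I) c i *: E (r @^-1` [set i]) x).
  by apply: compression_sum => i; exact: cV.
exact: (h x y).
Qed.

Lemma simple_fun_partition (I : finType) (r : X -> I) (c : I -> R[i]) :
  (forall i, measurable (r @^-1` [set i])) -> simple_fun (c \o r).
Proof.
move=> mr; split.
  apply: (@sub_finite_set _ _ (c @` [set: I])); last first.
    by apply: finite_image; exact: finite_finset.
  by move=> _ [t _ <-]; exists (r t).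
move=> v; rewrite (_ : _ @^-1` _ = \bigcup_(i in [set i | c i = v]) r @^-1` [set i]).
  by apply: fin_bigcup_measurable => // i _; exact: mr.
by apply/seteqP; split => t /=; [move=> h; exists (r t)|case=> i /= <- <-].
Qed.

Lemma simple_funD s s' : simple_fun s -> simple_fun s' ->
  simple_fun (fun t : X => s t + s' t : R[i]).
Proof.
move=> ss ss'; have [I [r [c [c' [mr -> ->]]]]] := simple_fun2_partition ss ss'.
exact: (simple_fun_partition (fun i => c i + c' i) mr).
Qed.

Lemma simple_funM s s' : simple_fun s -> simple_fun s' ->
  simple_fun (fun t : X => s t * s' t : R[i]).
Proof.
move=> ss ss'; have [I [r [c [c' [mr -> ->]]]]] := simple_fun2_partition ss ss'.
exact: (simple_fun_partition (fun i => c i * c' i) mr).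
Qed.

Lemma simple_fun_cst (a : R[i]) : simple_fun ((fun=> a) : X -> R[i]).
Proof.
apply: (@simple_fun_partition unit (fun=> tt) (fun=> a)) => -[].
by rewrite (_ : _ @^-1` _ = setT) //; apply/seteqP; split.
Qed.

Lemma simple_integralD H (E : set X -> {linear H -> H}) s s' x :
  semi_spectral E -> simple_fun s -> simple_fun s' ->
  simple_integral E (fun t => s t + s' t) x =
  simple_integral E s x + simple_integral E s' x.
Proof.
move=> sE ss ss'.
have [I [r [c [c' [mr -> ->]]]]] := simple_fun2_partition ss ss'.
rewrite !(simple_integral_partition mr) //.
rewrite (simple_integral_partition mr (fun i => c i + c' i)) // -big_split /=.
by apply: eq_bigr => i _; rewrite scalerDl.
Qed.

Lemma simple_integralM H (F : set X -> {linear H -> H}) s s' x :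
  spectral F -> simple_fun s -> simple_fun s' ->
  simple_integral F (fun t => s t * s' t) x =
  simple_integral F s (simple_integral F s' x).
Proof.
move=> sF ss ss'.
have [I [r [c [c' [mr -> ->]]]]] := simple_fun2_partition ss ss'.
have [sF1 _] := sF; rewrite !(simple_integral_partition mr) //.
rewrite (simple_integral_partition mr (fun i => c i * c' i)) //.
by rewrite partition_integralM.
Qed.

Lemma simple_integral_cst H (E : set X -> {linear H -> H}) a x :
  semi_spectral E -> simple_integral E (fun=> a) x = a *: x.
Proof.
move=> sE.
have mr (i : unit) : measurable ((fun _ : X => tt) @^-1` [set i]).
  by rewrite (_ : _ @^-1` _ = setT) //; apply/seteqP; split => //= ? _; case: i.
rewrite (simple_integral_partition mr (fun=> a)) // /partition_integral.
by rewrite -scaler_sumr semi_spectral_sum_fibres.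
Qed.

End Integral.

Section UniformLimits.
Context {R : realType}.

Lemma uniform_cvgP (U : choiceType) (A : set U) (s : nat -> U -> R[i]) f :
  {uniform A, s @ \oo --> f} <->
  forall e : R[i], 0 < e ->
    \forall n \near \oo, forall t, A t -> `|s n t - f t| <= e.
Proof.
split=> [h e e0|h].
  have /h : nbhs (f : {uniform` A -> R[i]})
      [set g | forall t, A t -> `|g t - f t| <= e].
    apply/uniform_nbhs; exists [set xy | ball xy.1 e xy.2]; split.
      exact: entourage_ball (PosNum e0).
    move=> g gf t At /=; have := gf t At.
    by rewrite -ball_normE /ball_ /= distrC => /ltW.
  by [].
move=> P /uniform_nbhs[E [entE sE]].
move: entE; rewrite -entourage_ballE => -[e /= e0 eE].
have e20 : 0 < e / 2 by rewrite divr_gt0.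
near=> n; apply: sE => t At; apply: eE.
rewrite /= -ball_normE /ball_ /= distrC.
apply: (@le_lt_trans _ _ (e / 2)); last first.
  by rewrite ltr_pdivrMr // mulr_natr mulr2n ltrDl.
by move: t At; near: n; exact: h.
Unshelve. all: by end_near. Qed.

End UniformLimits.

(** * Uniform integrals *)

Section UniformIntegral.
Context {R : realType} d {X : measurableType d}.
Implicit Types (H K : hilbertType R) (u v : X -> R[i]).

Definition uniform_simple_limit u : Prop :=
  forall e : R[i], 0 < e ->
    exists2 s, simple_fun s & forall t, `|s t - u t| <= e.

(** An intrinsic form of the integral: only [E] enters, so operators obtained from different
    dilations become comparable. *)
Definition uniform_integral H (E : set X -> {linear H -> H}) u (A : H -> H) :=
  forall e : R[i], 0 < e ->
    exists s, [/\ simple_fun s, forall t, `|s t - u t| <= e &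
      forall x, `|simple_integral E s x - A x| <= e * `|x|].

Lemma ler_scaled_addgt0 H (a b c : R[i]) (x : H) : 0 <= c ->
  (forall e, 0 < e -> a <= b + c * e * `|x|) -> a <= b.
Proof.
move=> c0 h; apply/ler_addgt0Pr => e e0.
have p0 : 0 < 1 + c * `|x| by rewrite ltr_pwDl // mulr_ge0.
apply: le_trans (h _ (divr_gt0 e0 p0)) _.
rewrite lerD2l; have -> : c * (e / (1 + c * `|x|)) * `|x| =
  e * (c * `|x|) / (1 + c * `|x|) by ring.
by rewrite ler_pdivrMr // ler_wpM2l ?(ltW e0) // lerDr.
Qed.

Lemma near_natSinv_le (e : R[i]) : 0 < e -> \forall n \near \oo, n.+1%:R^-1 <= e.
Proof.
move=> e0; have eR : e = (complex.Re e)%:C by rewrite RRe_real // gtr0_real.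
have e0' : 0 < complex.Re e by rewrite -ltcR -eR.
near=> n; rewrite eR.
have -> : (n.+1%:R^-1 : R[i]) = (n.+1%:R^-1)%:C.
  by rewrite fmorphV rmorph_nat.
by rewrite lecR; apply: ltW; near: n; exact: near_infty_natSinv_lt (PosNum e0').
Unshelve. all: by end_near. Qed.

(** The definition provides one good simple function for each [e]; boundedness of the integral
    extends the estimate to every simple function close to [u]. *)
Lemma uniform_integral_rigid H (E : set X -> {linear H -> H}) u A s
    (M : R[i]) x :
  bounded_integral E -> uniform_integral E u A -> simple_fun s -> 0 < M ->
  (forall t, `|s t - u t| <= M) ->
  `|simple_integral E s x - A x| <= 2 * M * `|x|.
Proof.
move=> bE uiA ss M0 le.
apply: (@ler_scaled_addgt0 _ _ _ 3 x) => // e e0.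
have [s' [ss' le' I']] := uiA _ e0.
apply: (le_trans (ler_distD (simple_integral E s' x) _ _)).
have h : `|simple_integral E s x - simple_integral E s' x| <=
    2 * (M + e) * `|x|.
  apply: bE => //; first exact: addr_gt0.
  move=> t; apply: (le_trans (ler_distD (u t) _ _)); apply: lerD => //.
  by rewrite distrC.
apply: (le_trans (lerD h (I' x))).
by rewrite le_eqVlt; apply/orP; left; apply/eqP; ring.
Qed.

Lemma uniform_integral_unique H (E : set X -> {linear H -> H}) u A B :
  bounded_integral E -> uniform_integral E u A -> uniform_integral E u B ->
  A =1 B.
Proof.
move=> bE uiA uiB x; apply/eqP; rewrite -subr_eq0 -normr_le0.
apply: (@ler_scaled_addgt0 _ _ _ 3 x) => // e e0.
have [s [ss le I]] := uiA _ e0.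
have h := uniform_integral_rigid x bE uiB ss e0 le.
apply: (le_trans (ler_distD (simple_integral E s x) _ _)).
rewrite distrC add0r; apply: (le_trans (lerD (I x) h)).
by rewrite le_eqVlt; apply/orP; left; apply/eqP; ring.
Qed.

Lemma uniform_integral_spectral H (E : set X -> {linear H -> H}) u A :
  is_spectral_integral E u A <-> uniform_integral E u A.
Proof.
split=> [[s [ss us Is]] e e0|uiA].
  have /uniform_cvgP/(_ _ e0) us' := us.
  have [n [h1 h2]] := filter_ex (filterI us' (Is _ e0)).
  by exists (s n); split => // t; exact: h1.
have n0 n : 0 < (n.+1%:R^-1 : R[i]) by rewrite invr_gt0 ltr0n.
pose s n := projT1 (cid (uiA _ (n0 n))).
have sP n := projT2 (cid (uiA _ (n0 n))).
exists s; split.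
- by move=> n; have [] := sP n.
- apply/uniform_cvgP => e e0; near=> n => t _.
  have [_ le _] := sP n; apply: (le_trans (le t)).
  by near: n; exact: near_natSinv_le.
- move=> e e0; near=> n => x; have [_ _ le] := sP n.
  apply: (le_trans (le x)); rewrite ler_wpM2r //.
  by near: n; exact: near_natSinv_le.
Unshelve. all: by end_near. Qed.

Lemma uniform_integral_exists H (E : set X -> {linear H -> H}) u :
  bounded_integral E -> uniform_simple_limit u ->
  exists A, uniform_integral E u A.
Proof.
move=> bE uu.
have n0 n : 0 < (n.+1%:R^-1 : R[i]) by rewrite invr_gt0 ltr0n.
pose s n := projT1 (cid2 (uu _ (n0 n))).
have ss n : simple_fun (s n) by rewrite /s; case: cid2.
have su n t : `|s n t - u t| <= n.+1%:R^-1 by rewrite /s; case: cid2.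
have dist n m (e : R[i]) x : 0 < e -> n.+1%:R^-1 <= e -> m.+1%:R^-1 <= e ->
    `|simple_integral E (s n) x - simple_integral E (s m) x| <= 4 * e * `|x|.
  move=> e0 ne me; have -> : 4 * e = 2 * (e + e) by ring.
  apply: bE => //; first exact: addr_gt0.
  move=> t; apply: (le_trans (ler_distD (u t) _ _)); apply: lerD.
    exact: le_trans (su n t) ne.
  by rewrite distrC; exact: le_trans (su m t) me.
have cv x : cvg ((fun n => simple_integral E (s n) x) @ \oo).
  apply/cauchy_cvgP/cauchy_ballP => e e0.
  have p0 : 0 < 1 + 4 * `|x| by rewrite ltr_pwDl // mulr_ge0.
  pose e' := e / (1 + 4 * `|x|).
  have e'0 : 0 < e' by exact: divr_gt0.
  rewrite near_map2; near=> n m => /=; rewrite -ball_normE /ball_ /=.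
  apply: (@le_lt_trans _ _ (4 * e' * `|x|)).
    by apply: dist => //; [near: n|near: m]; exact: near_natSinv_le.
  have -> : 4 * e' * `|x| = e * (4 * `|x|) / (1 + 4 * `|x|) by rewrite /e'; ring.
  by rewrite ltr_pdivrMr // ltr_pM2l // ltrDr.
exists (fun x => lim ((fun n => simple_integral E (s n) x) @ \oo)) => e e0.
have e40 : 0 < e / 5 by rewrite divr_gt0.
have [N HN] := filter_ex (near_natSinv_le e40).
exists (s N); split => //.
  move=> t; apply: (le_trans (su N t)); apply: (le_trans HN).
  by rewrite ler_pdivrMr // ler_peMr ?(ltW e0) // ler1n.
move=> x; apply/ler_addgt0Pr => e1 e10.
have /cvgrPdist_le/(_ _ e10) h1 := cv x.
have [m [hm1 hm2]] := filter_ex (filterI h1 (near_natSinv_le e40)).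
apply: (le_trans (ler_distD (simple_integral E (s m) x) _ _)).
apply: lerD; last by rewrite distrC.
apply: (le_trans (dist _ _ _ _ e40 HN hm2)).
rewrite ler_wpM2r // mulrA ler_pdivrMr // mulrC ler_wpM2l ?(ltW e0) //.
by rewrite ler_nat.
Unshelve. all: by end_near. Qed.

Lemma uniform_integral_compression H K (E : set X -> {linear H -> H})
    (V : {linear H -> K}) F u A B :
  spectral_dilation E V F -> uniform_integral F u B -> compression V B A ->
  uniform_integral E u A.
Proof.
move=> dil uiB cBA e e0; have [iV _ _] := dil.
have [s [ss le Is]] := uiB _ e0.
exists s; split => // x.
have cs := simple_integral_compression dil ss.
have := compression_le x iV (compressionD cs (compressionZ (-1) cBA)).
rewrite !scaleN1r => /le_trans; apply.
by rewrite -[X in _ <= _ * X]iV.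
Qed.

Lemma uniform_integral_lim H (E : set X -> {linear H -> H})
    (u_ : nat -> X -> R[i]) (A_ : nat -> H -> H) u A :
  (forall n, uniform_integral E (u_ n) (A_ n)) ->
  {uniform, u_ @ \oo --> u} -> op_cvg A_ A -> uniform_integral E u A.
Proof.
move=> ui /uniform_cvgP cu cA e e0.
have e20 : 0 < e / 2 by rewrite divr_gt0.
have [n [h1 h2]] := filter_ex (filterI (cu _ e20) (cA _ e20)).
have [s [ss le Is]] := ui n _ e20.
exists s; split => // [t|x].
  apply: (le_trans (ler_distD (u_ n t) _ _)).
  by rewrite [X in _ <= X](splitr e) lerD // h1.
apply: (le_trans (ler_distD (A_ n x) _ _)).
by rewrite [X in _ <= X * _](splitr e) mulrDl lerD.
Qed.

Lemma uniform_integral_cst H (E : set X -> {linear H -> H}) a :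
  semi_spectral E -> uniform_integral E (fun=> a) (fun x => a *: x).
Proof.
move=> sE e e0; exists (fun=> a); split => [|t|x].
- exact: simple_fun_cst.
- by rewrite subrr normr0 ltW.
- by rewrite simple_integral_cst // subrr normr0 mulr_ge0 // ltW.
Qed.

Lemma uniform_integralD H (E : set X -> {linear H -> H}) u v A B :
  semi_spectral E -> uniform_integral E u A -> uniform_integral E v B ->
  uniform_integral E (fun t => u t + v t) (fun x => A x + B x).
Proof.
move=> sE ua vb e e0.
have e20 : 0 < e / 2 by rewrite divr_gt0.
have [s [ss su Is]] := ua _ e20; have [s' [ss' su' Is']] := vb _ e20.
exists (fun t => s t + s' t); split => [|t|x].
- exact: simple_funD.
- rewrite opprD addrACA (splitr e); apply: (le_trans (ler_normD _ _)).
  exact: lerD.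
- rewrite simple_integralD // opprD addrACA (splitr e) mulrDl.
  by apply: (le_trans (ler_normD _ _)); exact: lerD.
Qed.

(** Multiplicativity rests on the orthogonality of disjoint fibres, hence on [F] being spectral. *)
Lemma uniform_integralM H (F : set X -> {linear H -> H}) u v A B (c : R[i]) :
  spectral F -> 1 <= c ->
  (forall t, `|u t| <= c) -> (forall t, `|v t| <= c) ->
  (forall x, `|B x| <= c * `|x|) ->
  uniform_integral F u A -> uniform_integral F v B ->
  uniform_integral F (fun t => u t * v t) (fun x => A (B x)).
Proof.
move=> sF c1 uc vc Bc ua vb e e0.
have c0 : 0 < c by exact: lt_le_trans c1.
(* This makes e' <= 1 <= c and 5 c e' <= e. The two errors to come are (2 c + e') e' and (3 c + 2
   e') e' |x|, covered by 5 c e' and 5 c e' |x|. *)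
pose p := 1 + e + 5 * c.
have p0 : 0 < p by rewrite !addr_gt0 // mulr_gt0.
pose e' := e / p.
have e'0 : 0 < e' by exact: divr_gt0.
have e'1 : e' <= 1.
  by rewrite ler_pdivrMr // mul1r /p addrAC lerDr addr_ge0 // mulr_ge0 // ltW.
have e'c : 5 * c * e' <= e.
  rewrite mulrA ler_pdivrMr // mulrC ler_wpM2l ?(ltW e0) //.
  by rewrite /p lerDr addr_ge0 // ltW.
have [s [ss su Is]] := ua _ e'0; have [s' [ss' su' Is']] := vb _ e'0.
have sc t : `|s t| <= c + e'.
  rewrite -[s t](subrK (u t)) addrC; apply: (le_trans (ler_normD _ _)).
  exact: lerD.
exists (fun t => s t * s' t); split => [|t|x].
- exact: simple_funM.
- have -> : s t * s' t - u t * v t = s t * (s' t - v t) + (s t - u t) * v t.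
    by ring.
  apply: (le_trans (ler_normD _ _)); rewrite !normrM.
  apply: (le_trans (lerD (ler_pM _ _ (sc t) (su' t))
                         (ler_pM _ _ (su t) (vc t)))) => //.
  apply: le_trans e'c.
  have -> : (c + e') * e' + e' * c = (2 * c + e') * e' by ring.
  rewrite ler_wpM2r ?(ltW e'0) //.
  have -> : 5 * c = 2 * c + 3 * c by ring.
  rewrite lerD2l; apply: (le_trans e'1); apply: (le_trans c1).
  by rewrite ler_peMl ?(ltW c0) // ler1n.
- have [sF1 _] := sF.
  rewrite simple_integralM // -[simple_integral F s _](subrK
    (simple_integral F s (B x))) -addrA.
  apply: (le_trans (ler_normD _ _)).
  have lin y z : simple_integral F s y - simple_integral F s z =
      simple_integral F s (y - z).
    have [I [r [f1 [f2 [mr -> _]]]]] := simple_fun2_partition ss ss.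
    rewrite !(simple_integral_partition mr) // -sumrB; apply: eq_bigr => i _.
    by rewrite linearB scalerBr.
  rewrite lin.
  have bs y : `|simple_integral F s y| <= 2 * (c + e') * `|y|.
    have h t : `|s t - 0| <= c + e' by rewrite subr0.
    have := semi_spectral_bounded_integral sF1 ss (simple_fun_cst 0)
      (addr_gt0 c0 e'0) h y.
    by rewrite simple_integral_cst // scale0r subr0.
  apply: (le_trans (lerD (bs _) (Is _))).
  have h1 : 2 * (c + e') * `|simple_integral F s' x - B x| <=
      2 * (c + e') * (e' * `|x|).
    by apply: ler_wpM2l; rewrite ?Is' // mulr_ge0 // addr_ge0 // ltW.
  have h2 : e' * `|B x| <= e' * (c * `|x|) by rewrite ler_wpM2l // ltW.
  apply: (le_trans (lerD h1 h2)).
  have -> : 2 * (c + e') * (e' * `|x|) + e' * (c * `|x|) =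
    (3 * c + 2 * e') * e' * `|x| by ring.
  rewrite ler_wpM2r //; apply: le_trans e'c; rewrite ler_wpM2r ?(ltW e'0) //.
  have -> : 5 * c = 3 * c + 2 * c by ring.
  by rewrite lerD2l ler_wpM2l // (le_trans e'1).
Qed.

End UniformIntegral.

(** * Semi-spectral integrals and the disk calculus *)

Section SemiSpectralIntegral.
Context {R : realType}.
Implicit Types H K : hilbertType R.

(* Twice the Cauchy-Schwarz bound, which is all that is needed. *)
Lemma inner_le H (x y : H) : `|inner x y| <= 2 * (`|x| * `|y|).
Proof.
have [->|x0] := eqVneq x 0; first by rewrite inner0l !normr0 mul0r mulr0.
have [->|y0] := eqVneq y 0.
  by rewrite innerC inner0l conjC0 !normr0 !mulr0.
have nx : 0 < `|x| by rewrite normr_gt0.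
have ny : 0 < `|y| by rewrite normr_gt0.
have id0 (z : H) : 0 <= inner (idfun z) z by rewrite innerxx exprn_ge0.
have := @polarization_le _ _ idfun (`|x|^-1 *: x) (`|y|^-1 *: y) id0.
rewrite /= !innerxx !normrZ !normfV !normr_id !mulVf ?gt_eqF // expr1n.
rewrite innerZl innerZr !normrM norm_conjC !normfV !normr_id -(mulr2n 1).
by rewrite mulrA -invfM mulrC ler_pdivrMr ?mulr_gt0 // mulr2n.
Qed.

Section Dilation.
Context {d} {X : measurableType d}.

(** Simple integrals against [E] are compressions of those against [F], and a single simple function
    close to [u] approximates both [A] and [B]. *)
Lemma compression_uniform_integral H K (E : set X -> {linear H -> H})
    (V : {linear H -> K}) F u A B :
  spectral_dilation E V F -> uniform_integral F u B -> uniform_integral E u A ->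
  compression V B A.
Proof.
move=> dil uiB uiA x y; rewrite -/(inner _ _).
have [iV sF _] := dil; have bE := dilation_bounded_integral dil.
apply/eqP; rewrite -normr_le0.
apply: (@ler_scaled_addgt0 _ _ _ _ (6 * `|x|) y); first by rewrite mulr_ge0.
move=> e e0; rewrite add0r.
have [s [ss su Is]] := uiB _ e0.
have h1 := uniform_integral_rigid x bE uiA ss e0 su.
have c : inner (simple_integral F s (V x) - V (simple_integral E s x)) (V y) = 0.
  exact: (simple_integral_compression dil ss).
have -> : inner (B (V x) - V (A x)) (V y) =
    inner (V (simple_integral E s x - A x)) (V y) -
    inner (simple_integral F s (V x) - B (V x)) (V y).
  move: c; rewrite linearB !innerBl => /eqP; rewrite subr_eq0 => /eqP ->.
  by ring.
apply: (le_trans (ler_normB _ _)).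
apply: (le_trans (lerD (inner_le _ _) (inner_le _ _))); rewrite !iV.
have h2 := Is (V x); rewrite iV in h2.
apply: (@le_trans _ _ (2 * (2 * e * `|x| * `|y|) + 2 * (e * `|x| * `|y|))).
  by apply: lerD; rewrite ler_wpM2l // ler_wpM2r.
by rewrite le_eqVlt; apply/orP; left; apply/eqP; ring.
Qed.

(** The operator picked by [xget] may come from another dilation, but compressing that dilation
    makes it a [uniform_integral] of [E], and these are unique. *)
Lemma semi_spectral_integral_eq H K (E : set X -> {linear H -> H})
    (V : {linear H -> K}) F u A :
  spectral_dilation E V F -> uniform_integral E u A ->
  semi_spectral_integral E u = A.
Proof.
move=> dil uiA; have bE := dilation_bounded_integral dil.
have [iV [sF _] _] := dil.
have uu : uniform_simple_limit u.
  by move=> e e0; have [s [ss su _]] := uiA _ e0; exists s.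
have [B uiB] := uniform_integral_exists (semi_spectral_bounded_integral sF) uu.
have ex : is_semi_spectral_integral E u A.
  exists K, V, F, B; split => //; first exact/uniform_integral_spectral.
  exact: compression_uniform_integral dil uiB uiA.
rewrite /semi_spectral_integral.
case: xgetP => [A' _ [K' [V' [F' [B' [dil' /uniform_integral_spectral uB' cB']]]]]|].
  apply/funext; apply: (uniform_integral_unique bE) uiA.
  exact: uniform_integral_compression dil' uB' cB'.
by move=> /(_ A).
Qed.

End Dilation.

Section SpectralMeasureOf.
Variables (H : hilbertType R) (T : {linear H -> H}).
Variable E : set (circle_borel R) -> {linear H -> H}.
Hypothesis hE : semi_spectral_measure_of T E.

Lemma uniform_integral_iter K (U : {linear K -> K})
    (F : set (circle_borel R) -> {linear K -> K}) n :
  spectral F -> isometric_op U -> uniform_integral F sval U ->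
  uniform_integral F (fun z => sval z ^+ n) (iter n U).
Proof.
move=> sF iU uiU; have [sF1 _] := sF.
have n1 m (z : circle R) : `|sval z ^+ m| <= 1.
  by rewrite normrX (eqP (svalP z)) expr1n.
elim: n => [|n ih].
  have -> : iter 0 U = (fun x => 1 *: x).
    by apply/funext => x; rewrite scale1r.
  exact: uniform_integral_cst.
have -> : (fun z : circle R => sval z ^+ n.+1) = fun z => sval z * sval z ^+ n.
  by apply/funext => z; rewrite exprS.
apply: (@uniform_integralM _ _ _ _ _ _ _ _ _ 1) => // [t|x].
  by rewrite (eqP (svalP t)).
rewrite mul1r; elim: (n) => //= m; by rewrite iU.
Qed.

(** Powers of zeta are integrated against the spectral measure of the unitary dilation, where
    integration is multiplicative; the result is then compressed, U^n going to T^n. *)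
Lemma uniform_integral_poly p :
  uniform_integral E (fun z => p.[sval z]) (poly_calculus p T).
Proof.
have [K [V [U [F [[iU _] cUT uU dil]]]]] := hE.
have [_ sF _] := dil; have [sF1 _] := sF.
have {}uU : uniform_integral F sval U by exact/uniform_integral_spectral.
apply: (uniform_integral_compression dil (B := poly_calculus p U)); last first.
  by apply: compression_sum => i; exact: cUT.
rewrite /poly_calculus (_ : (fun z => _) =
    (fun z : circle R => \sum_(i < size p) p`_i * sval z ^+ i)); last first.
  by apply/funext => z; rewrite horner_coef.
have term (i : 'I_(size p)) : uniform_integral F
    (fun z => p`_i * sval z ^+ i) (fun x => p`_i *: iter i U x).
  have c1 : 1 <= 1 + `|p`_i| by rewrite lerDl.
  apply: (uniform_integralM sF c1).
  - by move=> _; rewrite lerDr.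
  - by move=> t; rewrite normrX (eqP (svalP t)) expr1n.
  - move=> x; apply: (@le_trans _ _ `|x|); last by rewrite ler_peMl.
    by elim: (nat_of_ord i) => //= m; rewrite iU.
  - exact: uniform_integral_cst.
  - exact: uniform_integral_iter.
elim: (index_enum _) => [|i s ih].
  have := uniform_integral_cst 0 sF1; congr uniform_integral.
    by apply/funext => z; rewrite big_nil.
  by apply/funext => x; rewrite big_nil scale0r.
have := uniform_integralD sF1 (term i) ih; congr uniform_integral.
  by apply/funext => z; rewrite big_cons.
by apply/funext => x; rewrite big_cons.
Qed.

(** Any limit of polynomial calculi is the integral of phi against [E], so it does not depend on the
    approximating polynomials. *)
Lemma disk_calculus_eq phi A :
  is_disk_calculus phi T A -> disk_calculus phi T = A.
Proof.
have [K [V [U [F [_ _ _ dil]]]]] := hE.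
have bE := dilation_bounded_integral dil.
have ui B : is_disk_calculus phi T B ->
    uniform_integral E (fun z => phi (sval z)) B.
  move=> [p [/uniform_cvgP up cB]].
  apply: uniform_integral_lim (fun n => uniform_integral_poly (p n)) _ cB.
  apply/uniform_cvgP => e e0; apply: filterS (up _ e0) => n h t _.
  by apply: h; rewrite /closed_disk /= (eqP (svalP t)).
move=> hA; rewrite /disk_calculus; case: xgetP => [B _ hB|/(_ A)//].
by apply/funext; exact: (uniform_integral_unique bE (ui _ hB) (ui _ hA)).
Qed.

(** A fine measurable partition of the circle is read off from a simple function approximating zeta,
    which exists because [U] is the integral of zeta. Points of one fibre share their approximate
    value, hence are close. *)
Lemma circle_sampling (e : R[i]) : 0 < e ->
  exists (I : finType) (r : circle_borel R -> I) (z : I -> circle R),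
    (forall i, measurable (r @^-1` [set i])) /\
    forall t, `|sval (z (r t)) - sval t| <= e.
Proof.
move=> e0; have [K [V [U [F [_ _ uU _]]]]] := hE.
have {}uU : uniform_integral F sval U by exact/uniform_integral_spectral.
have e20 : 0 < e / 2 by rewrite divr_gt0.
have [s [ss su _]] := uU _ e20.
have [I [r [c [_ [mr sE _]]]]] := simple_fun2_partition ss ss.
(* The default [expi 0] is taken only on empty fibres; the estimate concerns indices [r t], whose
   fibre contains t. *)
pose z i : circle R := xget (expi 0) [set t | r t = i].
exists I, r, z; split => // t.
have rz : r (z (r t)) = r t.
  by rewrite /z; case: xgetP => [t' _ /= ->//|/(_ t) /= ne]; case: ne.
have st : s t = s (z (r t)) by rewrite sE /= rz.
apply: (le_trans (ler_distD (s t) _ _)); rewrite (splitr e); apply: lerD => //.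
by rewrite distrC st.
Qed.

End SpectralMeasureOf.
End SemiSpectralIntegral.

(** * Continuous functions on the closed disk *)

Section ClosedDisk.
Variable R : realType.
Implicit Types f : R[i] -> R[i].

Lemma normC_real (x : R) : `|x%:C| = `|x|%:C :> R[i].
Proof. by rewrite normc_def /= expr0n /= addr0 sqrtr_sqr. Qed.

Lemma Re_normC (z : R[i]) : (complex.Re `|z|)%:C = `|z|.
Proof. by rewrite RRe_real. Qed.

Lemma normC_le_ReIm (x y : R) : `|x +i* y| <= (`|x| + `|y|)%:C.
Proof.
have -> : x +i* y = x%:C + 'i * y%:C by rewrite [LHS]complexE.
apply: (le_trans (ler_normD _ _)).
by rewrite normrM ?complexiE normCi mul1r !normC_real rmorphD.
Qed.

Lemma closed_disk_compact : compact (closed_disk R).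
Proof.
pose g (p : R * R) : R[i] := p.1 +i* p.2.
have cg : continuous g.
  move=> [x y]; apply/cvgrPdist_le => e e0.
  have eR : e = (complex.Re e)%:C by rewrite RRe_real // gtr0_real.
  have e20 : 0 < complex.Re e / 2 by rewrite divr_gt0 // -ltcR -eR.
  have /cvgrPdist_le/(_ _ e20) cx : (fun p : R * R => p.1) @ (x, y) --> x.
    exact: cvg_fst.
  have /cvgrPdist_le/(_ _ e20) cy : (fun p : R * R => p.2) @ (x, y) --> y.
    exact: cvg_snd.
  near=> p.
  rewrite /g /=; have -> : x +i* y - (p.1 +i* p.2) = (x - p.1) +i* (y - p.2) by [].
  apply: (le_trans (normC_le_ReIm _ _)); rewrite eR lecR (splitr (complex.Re e)).
  apply: lerD; near: p.
    exact: cx.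
  exact: cy.
apply: (@subclosed_compact _ _ (g @` (`[-1, 1] `*` `[-1, 1]))).
- rewrite -openC openE => z /= /negP; rewrite -real_ltNge // => z1.
  apply/nbhs_ballP; exists (`|z| - 1); first by rewrite /= subr_gt0.
  move=> w; rewrite -ball_normE /ball_ /= => zw w1.
  have h : `|z| <= `|z - w| + `|w| by have := ler_distD w z 0; rewrite !subr0.
  by have := le_lt_trans h (ltr_leD zw w1); rewrite subrK ltxx.
- apply: continuous_compact; first exact: continuous_subspaceT.
  apply: compact_setX; exact: segment_compact.
- move=> [x y]; rewrite /closed_disk /= normc_def /= lecR => h.
  have h1 : Num.sqrt (x ^+ 2 + y ^+ 2) <= 1 by [].
  have le (a b : R) : `|a| <= Num.sqrt (a ^+ 2 + b ^+ 2).
    by rewrite -sqrtr_sqr ler_wsqrtr // lerDl sqr_ge0.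
  exists (x, y) => //=; rewrite !in_itv /= -!ler_norml.
  split; first exact: le_trans (le x y) h1.
  by apply: le_trans h1; rewrite addrC; exact: le.
Unshelve. all: by end_near. Qed.

Lemma disk_uniform_continuous f (e : R[i]) :
  {within closed_disk R, continuous f} -> 0 < e ->
  \forall k \near \oo, forall z w, closed_disk R z -> closed_disk R w ->
    `|z - w| <= k.+1%:R^-1 -> `|f z - f w| <= e.
Proof.
move=> /subspace_continuousP cf e0.
have e20 : 0 < e / 2 by rewrite divr_gt0.
have := closed_disk_compact.
(* Compactness in covering form: a property that holds for all large k near each point of the disk
   holds for all large k on the whole disk. *)
move=> /compact_near_coveringP/near_covering_withinP.
move=> /(_ nat \oo (fun k z => forall w, closed_disk R w ->
    `|z - w| <= k.+1%:R^-1 -> `|f z - f w| <= e)) cov.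
have {}cov := cov _.
suff : \forall k \near \oo, closed_disk R `<=`
    (fun z => forall w, closed_disk R w ->
      `|z - w| <= k.+1%:R^-1 -> `|f z - f w| <= e).
  by apply: filterS => k h z w dz dw; exact: h.
apply: cov => x Dx.
have /cvgrPdist_le/(_ _ e20) := cf x Dx.
rewrite /prop_near1 /within /= => /nbhs_ballP[d /= d0 hd].
have d20 : 0 < d / 2 by rewrite divr_gt0.
exists (ball x (d / 2), [set k | (k.+1%:R^-1 : R[i]) <= d / 4]) => /=.
  split; first exact: nbhsx_ballx.
  by apply: near_natSinv_le; rewrite divr_gt0.
move=> [z k] /= [zx kd] Dz w Dw zw.
rewrite -ball_normE /ball_ /= in hd zx.
have xz : `|x - z| < d.
  by apply: (lt_trans zx); rewrite ltr_pdivrMr // ltr_pMr // ltr1n.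
have xw : `|x - w| < d.
  apply: (le_lt_trans (ler_distD z _ _)); rewrite (splitr d).
  apply: ltr_leD => //; apply: (le_trans zw); apply: (le_trans kd).
  by rewrite ler_pM2l // lef_pV2 ?posrE // ler_nat.
apply: (le_trans (ler_distD (f x) _ _)); rewrite (splitr e) lerD //.
  by rewrite distrC; exact: hd.
exact: hd.
Qed.

Lemma disk_bounded f : {within closed_disk R, continuous f} ->
  exists M : R, forall z, closed_disk R z -> `|f z| <= M%:C.
Proof.
move=> /subspace_continuousP cf.
have := closed_disk_compact.
move=> /compact_near_coveringP/near_covering_withinP.
move=> /(_ nat \oo (fun k z => `|f z| <= k%:R)) cov.
have {}cov := cov _.
suff /filter_ex[n hn] : \forall k \near \oo, closed_disk R `<=`
    (fun z => `|f z| <= k%:R).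
  by exists n%:R => z Dz; rewrite rmorph_nat; exact: hn.
apply: cov => x Dx.
have /cvgrPdist_le/(_ _ ltr01) := cf x Dx.
rewrite /prop_near1 /within /= => hx.
exists ([set z | closed_disk R z -> `|f x - f z| <= 1],
        [set k | `|f x| + 1 <= k%:R]) => /=.
  split => //; near=> k.
  have -> : `|f x| + 1 = (complex.Re `|f x| + 1)%:C.
    by rewrite rmorphD rmorph1 /= Re_normC.
  apply: (@le_trans _ _ (k%:R : R)%:C); last by rewrite rmorph_nat.
  by rewrite lecR; near: k; exact: nbhs_infty_ger.
move=> [z k] /= [zx kd] Dz.
apply: le_trans kd; rewrite -[f z](subrK (f x)) addrC.
by apply: (le_trans (ler_normD _ _)); rewrite lerD // distrC; exact: zx.
Unshelve. all: by end_near. Qed.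

Lemma disk_norm_bound f z : {within closed_disk R, continuous f} ->
  closed_disk R z -> `|f z| <= (disk_norm f)%:C.
Proof.
move=> /disk_bounded[M hM] Dz; rewrite -Re_normC lecR.
apply: ub_le_sup; last by exists z.
by exists M => _ [w Dw <-]; rewrite -lecR Re_normC; exact: hM.
Qed.

Lemma disk_norm_ge0 f : {within closed_disk R, continuous f} ->
  0 <= disk_norm f.
Proof.
move=> cf; have D0 : closed_disk R 0 by rewrite /closed_disk /= normr0.
by rewrite -ler0c; apply: le_trans (disk_norm_bound cf D0).
Qed.

Lemma disk_norm_le f (M : R) :
  (forall z, closed_disk R z -> `|f z| <= M%:C) -> disk_norm f <= M.
Proof.
move=> h; apply: ge_sup.
  by exists (complex.Re `|f 0|), 0 => //; rewrite /closed_disk /= normr0.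
by move=> _ [z Dz <-]; rewrite -lecR Re_normC; exact: h.
Qed.
End ClosedDisk.

(** * Independence of the tensor representation *)

Section DoubleOperatorIntegral.
Context {R : realType}.
Implicit Types H K : hilbertType R.

Lemma series_tail_le (a : nat -> R) (e : R) :
  (forall n, 0 <= a n) -> cvgn (series a) -> 0 < e ->
  \forall N \near \oo, forall N', \sum_(N <= k < N') a k <= e.
Proof.
move=> a0 /cvg_cauchy/cauchy_seriesP/(_ _) h e0.
have [[P Q] /= [[n1 _ h1] [n2 _ h2]] PQ] := h _ e0.
exists (maxn n1 n2) => // N /=; rewrite geq_max => /andP[N1 N2] N'.
have [NN'|/ltnW NN'] := leqP N N'; last by rewrite big_geq // ltW.
have /= := PQ (N, N') (conj (h1 N N1) (h2 N' (leq_trans N2 NN'))).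
by move=> /ltW; apply: le_trans; exact: ler_norm.
Qed.

Lemma circle_closed_disk (t : circle R) : closed_disk R (sval t).
Proof. by rewrite /closed_disk /= (eqP (svalP t)). Qed.

Section Bounds.
Context {d} {X : measurableType d}.
Variables (H : hilbertType R) (E : set X -> {linear H -> H}).
Hypothesis bE : bounded_integral E.

Lemma simple_integral_le s (M : R[i]) x : simple_fun s -> 0 <= M ->
  (forall t, `|s t| <= M) -> `|simple_integral E s x| <= 2 * M * `|x|.
Proof.
move=> ss M0 sM; apply: (@ler_scaled_addgt0 _ _ _ _ 2 x) => // e e0.
have I0 : simple_integral E (fun=> 0) x = 0.
  by rewrite /simple_integral fsbig1 // => c [t _ <-]; rewrite scale0r.
have h t : `|s t - 0| <= M + e by rewrite subr0 (le_trans (sM t)) // lerDl ltW.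
have := bE ss (simple_fun_cst 0) (ltr_wpDl M0 e0) h x.
by rewrite I0 subr0 mulrDr mulrDl.
Qed.

Lemma uniform_integral_le u A (M : R[i]) x : uniform_integral E u A -> 0 <= M ->
  (forall t, `|u t| <= M) -> `|A x| <= 2 * M * `|x|.
Proof.
move=> uA M0 uM; apply: (@ler_scaled_addgt0 _ _ _ _ 3 x) => // e e0.
have [s [ss su Is]] := uA _ e0.
have sM t : `|s t| <= M + e.
  rewrite -(subrK (u t) (s t)) addrC; apply: (le_trans (ler_normD _ _)).
  exact: lerD.
have Me : 0 <= M + e by rewrite addr_ge0 // ltW.
rewrite -(subrK (simple_integral E s x) (A x)).
apply: (le_trans (ler_normD _ _)); rewrite distrC.
apply: (le_trans (lerD (Is x) (simple_integral_le x ss Me sM))).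
by rewrite le_eqVlt; apply/orP; left; apply/eqP; ring.
Qed.

End Bounds.

Lemma disk_uniform_simple_limit H (T : {linear H -> H})
    (E : set (circle_borel R) -> {linear H -> H}) (f : R[i] -> R[i]) :
  semi_spectral_measure_of T E -> {within closed_disk R, continuous f} ->
  @uniform_simple_limit R _ (circle_borel R) (f \o sval).
Proof.
move=> hE cf e e0.
have [k hk] := filter_ex (disk_uniform_continuous cf e0).
have k0 : 0 < (k.+1%:R^-1 : R[i]) by rewrite invr_gt0 ltr0n.
have [I [r [z [mr zr]]]] := circle_sampling hE k0.
exists ((fun i => f (sval (z i))) \o r); first exact: simple_fun_partition.
by move=> t; exact: hk (circle_closed_disk _) (circle_closed_disk _) (zr t).
Qed.

Lemma disk_semi_spectral_integral H (T : {linear H -> H})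
    (E : set (circle_borel R) -> {linear H -> H}) (f : R[i] -> R[i]) :
  semi_spectral_measure_of T E -> {within closed_disk R, continuous f} ->
  uniform_integral E (f \o sval) (semi_spectral_integral E (f \o sval)).
Proof.
move=> hE cf; have [K [V [U [F [_ _ _ dil]]]]] := hE.
have [A uA] := uniform_integral_exists (dilation_bounded_integral dil)
  (disk_uniform_simple_limit hE cf).
by rewrite (semi_spectral_integral_eq dil uA).
Qed.

Section Uniqueness.
Variables (H : hilbertType R) (T S Q : {linear H -> H}).
Variables (E1 E2 : set (circle_borel R) -> {linear H -> H}).
Hypothesis h1 : semi_spectral_measure_of T E1.
Hypothesis h2 : semi_spectral_measure_of S E2.
Variable q : R[i].
Hypothesis q0 : 0 <= q.
Hypothesis Qq : forall x, `|Q x| <= q * `|x|.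

Definition riemann_sum (Phi : circle R -> circle R -> R[i]) (I J : finType)
    (r1 : circle_borel R -> I) (z1 : I -> circle R)
    (r2 : circle_borel R -> J) (z2 : J -> circle R) (x : H) : H :=
  \sum_i \sum_j Phi (z1 i) (z2 j) *:
     E1 (r1 @^-1` [set i]) (Q (E2 (r2 @^-1` [set j]) x)).

(** The order of choices matters. First N makes the tail of the projective norm small, a bound that
    is uniform over all partitions; then uniform continuity of the first N pairs of functions fixes
    how fine the partition must be. *)
Lemma double_operator_integral_riemann Phi A x (e : R[i]) :
  is_double_operator_integral Phi E1 Q E2 A -> 0 < e ->
  \forall k \near \oo, forall (I J : finType) (r1 : circle_borel R -> I)
      (z1 : I -> circle R) (r2 : circle_borel R -> J) (z2 : J -> circle R),
    (forall i : I, measurable (r1 @^-1` [set i])) ->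
    (forall j : J, measurable (r2 @^-1` [set j])) ->
    (forall t, `|sval (z1 (r1 t)) - sval t| <= k.+1%:R^-1) ->
    (forall t, `|sval (z2 (r2 t)) - sval t| <= k.+1%:R^-1) ->
    `|A x - riemann_sum Phi r1 z1 r2 z2 x| <= e.
Proof.
move=> [f [g [[df dg sumfg cPhi] cA]]] e0.
have [K1 [V1 [U1 [F1 [_ _ _ dil1]]]]] := h1.
have [K2 [V2 [U2 [F2 [_ _ _ dil2]]]]] := h2.
have b1 := dilation_bounded_integral dil1.
have b2 := dilation_bounded_integral dil2.
have cf n := proj1 (df n); have cg n := proj1 (dg n).
pose a n := disk_norm (f n) * disk_norm (g n).
have fn0 n : 0 <= disk_norm (f n) by exact: disk_norm_ge0.
have gn0 n : 0 <= disk_norm (g n) by exact: disk_norm_ge0.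
have a0 n : 0 <= a n by rewrite mulr_ge0.
have cva := nnseries_is_cvg a0 sumfg.
(* Error budget: e' |x| from the convergence to [A], and 4 q e' |x| from each of [step1] and
   [step2]. *)
pose p := (1 + 8 * q) * (1 + `|x|).
have p0 : 0 < p.
  by rewrite mulr_gt0 ?ltr_pwDl // mulr_ge0.
have [e' e'0 e'E] : exists2 e' : R[i], 0 < e' & e' * p = e.
  by exists (e / p); rewrite ?divr_gt0 // divfK // gt_eqF.
have e'R : e' = (complex.Re e')%:C by rewrite RRe_real // gtr0_real.
have e'R0 : 0 < complex.Re e' by rewrite -ltcR -e'R.
have [N [tailN AN]] := filter_ex (filterI (series_tail_le a0 cva e'R0) (cA _ e'0)).
pose C := 1 + \sum_(n < N) (disk_norm (f n) + disk_norm (g n))%:C.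
have C0 : 0 < C.
  rewrite ltr_pwDl // sumr_ge0 // => n _; by rewrite ler0c addr_ge0.
have [eta eta0 etaE] : exists2 eta : R[i], 0 < eta & eta * C = e'.
  by exists (e' / C); rewrite ?divr_gt0 // divfK // gt_eqF.
have ucf : \forall k \near \oo, forall n : 'I_N, forall z w,
    closed_disk R z -> closed_disk R w ->
    `|z - w| <= k.+1%:R^-1 -> `|f n z - f n w| <= eta.
  by apply: filter_forall => n; exact: disk_uniform_continuous.
have ucg : \forall k \near \oo, forall n : 'I_N, forall z w,
    closed_disk R z -> closed_disk R w ->
    `|z - w| <= k.+1%:R^-1 -> `|g n z - g n w| <= eta.
  by apply: filter_forall => n; exact: disk_uniform_continuous.
apply: filterS2 ucf ucg => k uf ug I J r1 z1 r2 z2 mr1 mr2 zr1 zr2.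
pose X n := partition_integral r1 E1 (fun i => f n (sval (z1 i))).
pose Y n := partition_integral r2 E2 (fun j => g n (sval (z2 j))).
pose s1 n := (fun i => f n (sval (z1 i))) \o r1.
pose s2 n := (fun j => g n (sval (z2 j))) \o r2.
have ss1 n : simple_fun (s1 n) by exact: simple_fun_partition.
have ss2 n : simple_fun (s2 n) by exact: simple_fun_partition.
have XE n y : X n y = simple_integral E1 (s1 n) y.
  by rewrite (simple_integral_partition_dilation _ dil1 mr1 (ss1 n)).
have YE n y : Y n y = simple_integral E2 (s2 n) y.
  by rewrite (simple_integral_partition_dilation _ dil2 mr2 (ss2 n)).
have Xle n y : `|X n y| <= 2 * (disk_norm (f n))%:C * `|y|.
  rewrite XE; apply: simple_integral_le => //; first by rewrite ler0c.
  by move=> t; apply: disk_norm_bound => //; exact: circle_closed_disk.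
have Yle n y : `|Y n y| <= 2 * (disk_norm (g n))%:C * `|y|.
  rewrite YE; apply: simple_integral_le => //; first by rewrite ler0c.
  by move=> t; apply: disk_norm_bound => //; exact: circle_closed_disk.
pose A_ n := semi_spectral_integral E1 (f n \o sval).
pose B_ n := semi_spectral_integral E2 (g n \o sval).
have uA n : uniform_integral E1 (f n \o sval) (A_ n).
  exact: disk_semi_spectral_integral h1 (cf n).
have uB n : uniform_integral E2 (g n \o sval) (B_ n).
  exact: disk_semi_spectral_integral h2 (cg n).
have Ble n y : `|B_ n y| <= 2 * (disk_norm (g n))%:C * `|y|.
  apply: uniform_integral_le (uB n) _ _ => //; first by rewrite ler0c.
  by move=> t; apply: disk_norm_bound => //; exact: circle_closed_disk.
have AX (n : 'I_N) y : `|X n y - A_ n y| <= 2 * eta * `|y|.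
  rewrite XE; apply: uniform_integral_rigid (uA n) _ _ _ => // t.
  by apply: uf; [exact: circle_closed_disk|exact: circle_closed_disk|exact: zr1].
have BY (n : 'I_N) y : `|Y n y - B_ n y| <= 2 * eta * `|y|.
  rewrite YE; apply: uniform_integral_rigid (uB n) _ _ _ => // t.
  by apply: ug; [exact: circle_closed_disk|exact: circle_closed_disk|exact: zr2].
have Xlin n y z : X n (y - z) = X n y - X n z.
  rewrite /X /partition_integral -sumrB; apply: eq_bigr => i _.
  by rewrite linearB scalerBr.
pose L n y := X n (Q (Y n y)).
(* In the first N terms, exact integrals are replaced by integrals of functions sampled on the
   partition. *)
have step1 : `|\sum_(0 <= n < N) A_ n (Q (B_ n x)) - \sum_(0 <= n < N) L n x|
    <= 4 * q * e' * `|x|.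
  rewrite -sumrB big_mkord.
  have le (n : 'I_N) : `|A_ n (Q (B_ n x)) - L n x| <=
      4 * q * eta * `|x| * (disk_norm (f n) + disk_norm (g n))%:C.
    have -> : A_ n (Q (B_ n x)) - L n x =
      - (X n (Q (B_ n x)) - A_ n (Q (B_ n x))) - X n (Q (Y n x - B_ n x)).
      rewrite (linearB Q (Y n x) (B_ n x)) Xlin /L opprB.
      by rewrite [- (_ - X n (Q (B_ n x)))]opprB addrA subrK.
    apply: (le_trans (ler_normB _ _)); rewrite normrN.
    apply: (le_trans (lerD (AX _ _) (Xle _ _))).
    have l1 : 2 * eta * `|Q (B_ n x)| <=
        2 * eta * (q * (2 * (disk_norm (g n))%:C * `|x|)).
      rewrite ler_wpM2l ?mulr_ge0 ?(ltW eta0) //.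
      by apply: (le_trans (Qq _)); rewrite ler_wpM2l.
    have l2 : 2 * (disk_norm (f n))%:C * `|Q (Y n x - B_ n x)| <=
        2 * (disk_norm (f n))%:C * (q * (2 * eta * `|x|)).
      rewrite ler_wpM2l ?mulr_ge0 ?ler0c //.
      by apply: (le_trans (Qq _)); rewrite ler_wpM2l.
    apply: (le_trans (lerD l1 l2)); rewrite rmorphD /=.
    by rewrite le_eqVlt; apply/orP; left; apply/eqP; ring.
  apply: (le_trans (ler_norm_sum _ _ _)).
  apply: (le_trans (ler_sum _ (fun n _ => le n))).
  rewrite -mulr_sumr.
  apply: (@le_trans _ _ (4 * q * eta * `|x| * C)).
    by rewrite ler_wpM2l ?mulr_ge0 ?(ltW eta0) // /C lerDr.
  rewrite le_eqVlt; apply/orP; left; apply/eqP.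
  by rewrite -etaE; ring.
have LE n : \sum_(0 <= m < n) L m x = \sum_i \sum_j
    (\sum_(0 <= m < n) f m (sval (z1 i)) * g m (sval (z2 j))) *:
      E1 (r1 @^-1` [set i]) (Q (E2 (r2 @^-1` [set j]) x)).
  have Lm m : L m x = \sum_i \sum_j (f m (sval (z1 i)) * g m (sval (z2 j))) *:
      E1 (r1 @^-1` [set i]) (Q (E2 (r2 @^-1` [set j]) x)).
    rewrite /L /X /partition_integral; apply: eq_bigr => i _.
    rewrite /Y /partition_integral !linear_sum; apply: eq_bigr => j _.
    by rewrite linearZ /= linearZ /= scalerA.
  under eq_bigr do rewrite Lm.
  rewrite exchange_big /=; apply: eq_bigr => i _.
  by rewrite exchange_big /=; apply: eq_bigr => j _; rewrite scaler_suml.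
(* For a fixed partition only finitely many points are involved, so the pointwise convergence of the
   tensor series to [Phi] is enough. *)
have cL : (fun n => \sum_(0 <= m < n) L m x) @ \oo -->
    riemann_sum Phi r1 z1 r2 z2 x.
  rewrite (_ : (fun n => _) = fun n => \sum_i \sum_j
    (\sum_(0 <= m < n) f m (sval (z1 i)) * g m (sval (z2 j))) *:
      E1 (r1 @^-1` [set i]) (Q (E2 (r2 @^-1` [set j]) x))); last first.
    by apply/funext => n; exact: LE.
  rewrite /riemann_sum; apply: cvg_big => [|i _]; first exact: add_continuous.
  apply: cvg_big => [|j _]; first exact: add_continuous.
  apply: cvgZr_tmp; exact: cPhi.
have step2 : `|\sum_(0 <= n < N) L n x - riemann_sum Phi r1 z1 r2 z2 x|
    <= 4 * q * e' * `|x|.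
  apply/ler_addgt0Pr => c c0.
  move/cvgrPdist_le/(_ _ c0) : cL => cL.
  have [N' [NN' hN']] := filter_ex (filterI (nbhs_infty_ge N) cL).
  apply: (le_trans (ler_distD (\sum_(0 <= n < N') L n x) _ _)).
  apply: lerD; last by rewrite distrC.
  rewrite distrC (big_cat_nat _ NN') //= addrAC subrr add0r.
  apply: (le_trans (ler_norm_sum _ _ _)).
  have le n : `|L n x| <= 4 * q * `|x| * (a n)%:C.
    apply: (le_trans (Xle _ _)).
    have : `|Q (Y n x)| <= q * (2 * (disk_norm (g n))%:C * `|x|).
      by apply: (le_trans (Qq _)); rewrite ler_wpM2l.
    move=> /(ler_wpM2l (_ : 0 <= 2 * (disk_norm (f n))%:C)) h.
    apply: (le_trans (h _)); first by rewrite mulr_ge0 // ler0c.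
    by rewrite /a rmorphM /= le_eqVlt; apply/orP; left; apply/eqP; ring.
  apply: (le_trans (ler_sum_nat (fun n _ => le n))).
  have -> : 4 * q * e' * `|x| = 4 * q * `|x| * e' by ring.
  rewrite -mulr_sumr ler_wpM2l ?mulr_ge0 //.
  by rewrite e'R -rmorph_sum /= lecR.
apply: (le_trans (ler_distD (\sum_(0 <= n < N) A_ n (Q (B_ n x))) _ _)).
apply: (le_trans (lerD (_ : _ <= e' * `|x|)
  (ler_distD (\sum_(0 <= n < N) L n x) _ _))); first by rewrite distrC; exact: AN.
apply: (le_trans (lerD (lexx _) (lerD step1 step2))).
apply: (@le_trans _ _ ((1 + 8 * q) * e' * (1 + `|x|))).
  rewrite [X in X <= _](_ : _ = (1 + 8 * q) * e' * `|x|); last by ring.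
  by rewrite ler_wpM2l ?lerDr // mulr_ge0 ?(ltW e'0) // addr_ge0 // mulr_ge0.
rewrite le_eqVlt; apply/orP; left; apply/eqP.
by rewrite -e'E /p; ring.
Qed.

Lemma double_operator_integral_eq Phi A :
  is_double_operator_integral Phi E1 Q E2 A ->
  double_operator_integral Phi E1 Q E2 = A.
Proof.
move=> hA; rewrite /double_operator_integral; case: xgetP => [B _ hB|/(_ A)//].
apply/funext => x; apply/eqP; rewrite -subr_eq0 -normr_le0.
apply/ler_addgt0Pr => e e0; rewrite add0r.
have e20 : 0 < e / 2 by rewrite divr_gt0.
have [k [kA kB]] := filter_ex (filterI
  (double_operator_integral_riemann x hA e20)
  (double_operator_integral_riemann x hB e20)).
have k0 : 0 < (k.+1%:R^-1 : R[i]) by rewrite invr_gt0 ltr0n.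
have [I [r1 [z1 [mr1 zr1]]]] := circle_sampling h1 k0.
have [J [r2 [z2 [mr2 zr2]]]] := circle_sampling h2 k0.
have {}kA := kA I J r1 z1 r2 z2 mr1 mr2 zr1 zr2.
have {}kB := kB I J r1 z1 r2 z2 mr1 mr2 zr1 zr2.
apply: (le_trans (ler_distD (riemann_sum Phi r1 z1 r2 z2 x) _ _)).
by rewrite (splitr e) lerD // distrC.
Qed.

End Uniqueness.
End DoubleOperatorIntegral.

(** * Trigonometric estimates for polynomials *)

Lemma near_continuous (K : numFieldType) (T : topologicalType)
    (V : normedModType K) (g : T -> V) :
  (forall z (e : K), 0 < e -> \forall w \near z, `|g z - g w| <= e) ->
  continuous g.
Proof. by move=> h z; apply/cvgrPdist_le => e; exact: h. Qed.

Lemma continuous_horner (K : numFieldType) (p : {poly K}) :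
  continuous (fun z : K => p.[z]).
Proof.
elim/poly_ind: p => [|p c ih] z.
  rewrite (_ : (fun z => _) = cst 0); first exact: cst_continuous.
  by apply/funext => w; rewrite horner0.
have -> : (fun z => (p * 'X + c%:P).[z]) = (fun z : K => p.[z] * z + c).
  by apply/funext => w; rewrite !hornerE.
exact: (cvgD (cvgM (ih z) cvg_id) (cvg_cst c)).
Qed.

Lemma near_horner (K : numFieldType) (p : {poly K}) (z e : K) : 0 < e ->
  \forall w \near z, `|p.[z] - p.[w]| <= e.
Proof.
move=> e0; have /cvgrPdist_le : (fun w : K => p.[w]) @ z --> p.[z].
  exact: continuous_horner.
exact.
Qed.

Lemma derivable_horner (K : numFieldType) (p : {poly K}) (z : K) :
  derivable (fun z : K => p.[z]) z 1.
Proof.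
elim/poly_ind: p => [|p c ih].
  rewrite (_ : (fun z => _) = cst 0); first exact: derivable_cst.
  by apply/funext => w; rewrite horner0.
have -> : (fun z => (p * 'X + c%:P).[z]) =
    (fun z : K => p.[z]) * id + (cst c : K -> K).
  by apply/funext => w; rewrite !hornerE.
apply: derivableD; last exact: derivable_cst.
by apply: derivableM; [exact: ih|exact: derivable_id].
Qed.

Section PolynomialEstimates.
Variable R : realType.
Implicit Types p : {poly R[i]}.

Lemma primitive_root_exists n : (0 < n)%N ->
  exists xi : R[i], n.-primitive_root xi.
Proof.
move=> n0; pose p : {poly R[i]} := 'X^n - 1%:P.
have [r Dp] := closed_field_poly_normal p.
have mp : p \is monic by rewrite /p monicXnsubC.
rewrite (monicP mp) scale1r in Dp.
have rn : all n.-unity_root r.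
  by apply/allP => x; rewrite -root_prod_XsubC -Dp.
have ur : uniq r.
  by rewrite -separable_prod_XsubC -Dp separable_Xn_sub_1 // pnatr_eq0 -lt0n.
have sr : (n <= size r)%N.
  by rewrite -ltnS -(size_prod_XsubC r id) -Dp size_XnsubC.
by have /hasP[xi _] := has_prim_root n0 rn ur sr; exists xi.
Qed.

Section Means.
Variables (L : nat) (xi : R[i]).
Hypothesis xiP : L.-primitive_root xi.

Lemma primitive_root_norm : `|xi| = 1.
Proof.
have L0 := prim_order_gt0 xiP.
apply/eqP; rewrite -(@pexpr_eq1 _ _ L) // -normrX (prim_expr_order xiP).
by rewrite normr1.
Qed.

Lemma primitive_root_norm_exp k : `|xi ^+ k| = 1.
Proof. by rewrite normrX primitive_root_norm expr1n. Qed.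

Lemma sum_primitive_root (u v : nat) : (u < L)%N -> (v < L)%N ->
  \sum_(i < L) xi ^+ (i * u) * (xi ^+ (i * v))^*%R = (L * (u == v))%:R.
Proof.
move=> uL vL; have L0 := prim_order_gt0 xiP.
have xi0 : xi != 0 by rewrite -normr_eq0 primitive_root_norm oner_eq0.
have conjE k : (xi ^+ k)^*%R = (xi ^+ k)^-1.
  by rewrite invC_norm primitive_root_norm_exp expr1n invr1 mul1r.
pose w := xi ^+ u / xi ^+ v.
have -> : \sum_(i < L) xi ^+ (i * u) * (xi ^+ (i * v))^*%R = \sum_(i < L) w ^+ i.
  apply: eq_bigr => i _; rewrite conjE /w exprMn exprVn -!exprM.
  by rewrite ![(i * _)%N]mulnC.
have [e|uv] := eqVneq u v.
  rewrite muln1 (eq_bigr (fun=> 1)) => [|i _].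
    by rewrite sumr_const card_ord.
  by rewrite /w e divff ?expr1n // expf_neq0.
rewrite muln0.
have w1 : w != 1.
  apply: contra uv => /eqP we.
  have : xi ^+ u == xi ^+ v.
    by rewrite -[X in X == _](divfK (expf_neq0 v xi0)) -/w we mul1r.
  by rewrite (eq_prim_root_expr xiP) /= !modn_small.
have wL : w ^+ L = 1.
  by rewrite /w exprMn exprVn -!exprM ![(_ * L)%N]mulnC !exprM
    (prim_expr_order xiP) !expr1n invr1 mulr1.
have /eqP := subrX1 w L; rewrite wL subrr eq_sym mulf_eq0 subr_eq0.
by rewrite (negbTE w1) /= => /eqP.
Qed.

(** A mean value property: the polynomial p(z + c w) in w has degree below L, so averaging over the
    L-th roots of unity keeps exactly its constant term. *)
Lemma mean_horner p z c : (size p <= L)%N ->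
  \sum_(i < L) p.[z + c * xi ^+ i] = L%:R * p.[z].
Proof.
move=> pL; have L0 := prim_order_gt0 xiP.
pose q := p \Po (c%:P * 'X + z%:P).
have qE w : p.[z + c * w] = q.[w].
  by rewrite /q horner_comp !hornerE addrC.
have sq : (size q <= L)%N.
  have [e|c0] := eqVneq c 0.
    rewrite /q e mul0r add0r comp_polyCr.
    by apply: (leq_trans (size_polyC_leq1 _)).
  have := size_comp_poly2 p (_ : size (c%:P * 'X + z%:P) = 2%N).
  rewrite -/q => -> //.
  by rewrite size_MXaddC polyC_eq0 (negbTE c0) /= size_polyC c0.
under eq_bigr do rewrite qE.
have -> : p.[z] = q.[0] by rewrite -qE mulr0 addr0.
have coefE w : q.[w] = \sum_(k < L) q`_k * w ^+ k.
  exact: horner_coef_wide.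
under eq_bigr do rewrite coefE.
rewrite exchange_big /= horner_coef0.
rewrite (bigD1 (Ordinal L0)) //= [X in _ + X]big1 ?addr0 => [|k k0].
  under eq_bigr do rewrite expr0 mulr1.
  by rewrite sumr_const card_ord mulr_natl.
rewrite -mulr_sumr; have := sum_primitive_root (ltn_ord k) L0.
rewrite (negbTE (_ : (k : nat) != 0%N)) // muln0 => h.
rewrite (eq_bigr (fun i : 'I_L => xi ^+ (i * k) * (xi ^+ (i * 0))^*%R)).
  by rewrite h mulr0.
by move=> i _; rewrite muln0 expr0 rmorph1 mulr1 exprM.
Qed.

End Means.

Lemma disk_algebra_poly p : disk_algebra (fun z : R[i] => p.[z]).
Proof.
split; last by move=> z _; exact: (@derivable_horner R[i]).
by apply: continuous_subspaceT => z; exact: (@continuous_horner R[i]).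
Qed.

Lemma near_norm_horner p (z : R[i]) (e : R) : 0 < e ->
  \forall w \near z, `|complex.Re `|p.[z]| - complex.Re `|p.[w]| | <= e.
Proof.
move=> e0; have e0' : (0 : R[i]) < e%:C by rewrite -[0]/(0%:C) ltcR.
have h := @near_horner R[i] p z _ e0'.
apply: filterS h => w h; rewrite -lecR -normC_real rmorphB /= !Re_normC.
by apply: le_trans h; exact: ler_dist_dist.
Qed.

(* An interior maximum point [z] is the centre of a circle in the disk that
   touches the unit circle, and [p.[z]] is the mean of its values there. *)
Lemma poly_maximum_principle p (M : R[i]) :
  (forall z, `|z| = 1 -> `|p.[z]| <= M) -> forall z, `|z| <= 1 -> `|p.[z]| <= M.
Proof.
move=> pM.
have cg : {within closed_disk R, continuous (fun z => complex.Re `|p.[z]|)}.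
  by apply/continuous_subspaceT/near_continuous => z e; exact: near_norm_horner.
have [|z0 /set_mem D0 max0] := compact_EVT_max _ (@closed_disk_compact R) cg.
  by exists 0; rewrite /closed_disk /= normr0.
have {}max0 z : `|z| <= 1 -> `|p.[z]| <= `|p.[z0]|.
  by move=> z1; rewrite -[X in X <= _]Re_normC -[X in _ <= X]Re_normC lecR;
    apply: max0; exact: mem_set.
suff p0 : `|p.[z0]| <= M by move=> z /max0 /le_trans; exact.
have [/pM//|n1] := eqVneq `|z0| 1.
(* The direction of [z0]; any direction would do at the origin. *)
pose eta := if z0 == 0 then 1 else z0 / `|z0|.
have eta1 : `|eta| = 1.
  rewrite /eta; case: eqVneq => [_|z00]; first by rewrite normr1.
  by rewrite normrM normfV normr_id divff // normr_eq0.
have z0E : z0 = `|z0| * eta.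
  rewrite /eta; case: eqVneq => [->|z00]; first by rewrite normr0 mul0r.
  by rewrite mulrC divfK // normr_eq0.
pose c := (1 - `|z0|) * eta.
have c1 : `|c| = 1 - `|z0|.
  by rewrite normrM eta1 mulr1 ger0_norm // subr_ge0.
have b1 : `|z0 + c| = 1.
  by rewrite {1}z0E /c -mulrDl addrCA subrr addr0 mul1r.
have [xi xiP] := primitive_root_exists (ltn0Sn (size p)).
have mean := mean_horner xiP z0 c (leqnSn (size p)).
(* Of the size p + 1 sample points, [z0 + c] lies on the unit circle and contributes at most M; each
   other one contributes at most the maximum. Cancelling these size p copies bounds the maximum by
   M. *)
have : (size p).+1%:R * `|p.[z0]| <= M + (size p)%:R * `|p.[z0]|.
  rewrite -{1}(normr_nat R[i] (size p).+1) -normrM -mean big_ord_recl expr0 mulr1.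
  apply: (le_trans (ler_normD _ _)); apply: lerD; first exact: pM.
  apply: (le_trans (ler_norm_sum _ _ _)).
  rewrite mulr_natl -[X in _ *+ X]card_ord -sumr_const; apply: ler_sum => i _.
  apply: max0; apply: (le_trans (ler_normD _ _)).
  by rewrite normrM (primitive_root_norm_exp xiP) mulr1 c1 addrC subrK.
by rewrite -addn1 natrD mulrDl mul1r addrC lerD2r.
Qed.

(* The multiplier is the convolution of the indicators of [0, a[ and [0, b[;
   its kernel is the product of two Dirichlet kernels, whose mean modulus is
   bounded by AM-GM and Parseval. *)
Lemma trapezoid_multiplier p (M : R[i]) (a b c c' : nat) z :
  (forall w, `|w| = 1 -> `|p.[w]| <= M) -> `|z| = 1 ->
  `|\sum_(m < size p)
     (\sum_(l < a) \sum_(k < b) (m + c' == l + k + c)%N%:R) *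
       (p`_m * z ^+ m)| <= M * ((a + b)%:R / 2).
Proof.
move=> pM z1.
(* All exponents that occur are below L, so equality modulo L is equality. *)
pose L := (size p + c' + a + b + c).+1.
have [xi xiP] := @primitive_root_exists L isT.
have L0 : 0 < (L%:R : R[i]) by rewrite ltr0n.
pose W n i := \sum_(l < n) xi ^+ (i * l).
have parseval n : (n <= L)%N -> \sum_(i < L) `|W n i| ^+ 2 = (L * n)%:R.
  move=> nL; under eq_bigr => i _.
    rewrite normCK rmorph_sum mulr_suml.
    under eq_bigr do rewrite mulr_sumr.
    over.
  rewrite exchange_big /=; under eq_bigr do rewrite exchange_big /=.
  have h (l k : 'I_n) : \sum_(i < L) xi ^+ (i * l) * (xi ^+ (i * k))^*%R =
      (L * (l == k))%:R.
    by apply: (sum_primitive_root xiP); apply: leq_trans nL.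
  under eq_bigr => l _.
    under eq_bigr do rewrite h.
    rewrite (bigD1 l) //= eqxx muln1 big1 ?addr0; last first.
      by move=> k kl; rewrite eq_sym (negbTE kl) muln0.
    over.
  by rewrite sumr_const card_ord natrM mulr_natr.
rewrite -(ler_pM2l L0) -{1}(normr_nat R[i] L) -normrM.
have -> : L%:R * (\sum_(m < size p)
     (\sum_(l < a) \sum_(k < b) (m + c' == l + k + c)%N%:R) *
       (p`_m * z ^+ m)) =
   \sum_(i < L) p.[z * xi ^+ i] * xi ^+ (i * c') *
     (W a i * W b i * xi ^+ (i * c))^*%R.
  have term (i : 'I_L) : p.[z * xi ^+ i] * xi ^+ (i * c') *
     (W a i * W b i * xi ^+ (i * c))^*%R =
     \sum_(m < size p) \sum_(l < a) \sum_(k < b) p`_m * z ^+ m *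
       (xi ^+ (i * (m + c')) * (xi ^+ (i * (l + k + c)))^*%R).
    rewrite horner_coef /W -mulrA mulr_suml; apply: eq_bigr => m _.
    rewrite rmorphM rmorphM !rmorph_sum /= !mulr_suml !mulr_sumr.
    apply: eq_bigr => l _; rewrite mulr_sumr mulr_suml !mulr_sumr.
    apply: eq_bigr => k _.
    rewrite exprMn !mulnDr !exprD !rmorphM /= -(exprM xi i m); ring.
  under [RHS]eq_bigr do rewrite term.
  rewrite [RHS]exchange_big mulr_sumr; apply: eq_bigr => m _.
  rewrite [RHS]exchange_big mulr_suml mulr_sumr; apply: eq_bigr => l _.
  rewrite [RHS]exchange_big mulr_suml mulr_sumr; apply: eq_bigr => k _ /=.
  have mL : (m + c' < L)%N by rewrite /L; move: (ltn_ord m); lia.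
  have lL : (l + k + c < L)%N.
    by rewrite /L; move: (ltn_ord l) (ltn_ord k); lia.
  rewrite -mulr_sumr (sum_primitive_root xiP mL lL) natrM; ring.
apply: (le_trans (ler_norm_sum _ _ _)).
have le (i : 'I_L) : `|p.[z * xi ^+ i] * xi ^+ (i * c') *
    (W a i * W b i * xi ^+ (i * c))^*%R| <=
    M * ((`|W a i| ^+ 2 + `|W b i| ^+ 2) / 2).
  rewrite !normrM norm_conjC !normrM !(primitive_root_norm_exp xiP) !mulr1.
  apply: ler_pM; rewrite ?mulr_ge0 //.
    by apply: pM; rewrite normrM z1 (primitive_root_norm_exp xiP) mulr1.
  rewrite ler_pdivlMr // -subr_ge0.
  rewrite (_ : _ - _ = (`|W a i| - `|W b i|) ^+ 2); last by ring.
  by rewrite real_exprn_even_ge0 // rpredB.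
apply: (le_trans (ler_sum _ (fun i _ => le i))).
rewrite -mulr_sumr -mulr_suml big_split /= !parseval; try by rewrite /L; lia.
by rewrite !natrM natrD le_eqVlt; apply/orP; left; apply/eqP; ring.
Qed.

End PolynomialEstimates.

(** * Fourier coefficients *)

Section CircleFourier.
Variable R : realType.
Implicit Types (f g : circle R -> R[i]) (z : circle R).

Lemma ReD (x y : R[i]) : complex.Re (x + y) = complex.Re x + complex.Re y.
Proof. by case: x y => ? ? []. Qed.

Lemma ImD (x y : R[i]) : complex.Im (x + y) = complex.Im x + complex.Im y.
Proof. by case: x y => ? ? []. Qed.

Lemma ReM (x y : R[i]) : complex.Re (x * y) =
  complex.Re x * complex.Re y + - complex.Im x * complex.Im y.
Proof. by case: x y => ? ? [] ? ? /=; rewrite mulNr. Qed.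

Lemma ImM (x y : R[i]) : complex.Im (x * y) =
  complex.Re x * complex.Im y + complex.Im x * complex.Re y.
Proof. by case: x y => ? ? [] ? ? /=. Qed.

Lemma circle_integrableD f g : circle_integrable f -> circle_integrable g ->
  circle_integrable (fun z => f z + g z).
Proof.
move=> [f1 f2] [g1 g2]; split.
  under eq_fun do rewrite ReD EFinD; exact: integrableD.
under eq_fun do rewrite ImD EFinD; exact: integrableD.
Qed.

Lemma circle_integrableZ c f : circle_integrable f ->
  circle_integrable (fun z => c * f z).
Proof.
move=> [f1 f2]; split.
  under eq_fun do rewrite ReM EFinD !EFinM.
  by apply: integrableD => //; exact: integrableZl.
under eq_fun do rewrite ImM EFinD !EFinM.
by apply: integrableD => //; exact: integrableZl.
Qed.

Lemma circle_integralD f g : circle_integrable f -> circle_integrable g ->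
  circle_integral (fun z => f z + g z) = circle_integral f + circle_integral g.
Proof.
move=> [f1 f2] [g1 g2]; rewrite /circle_integral.
under eq_Rintegral do rewrite ReD.
under [X in _ +i* X]eq_Rintegral do rewrite ImD.
by rewrite !RintegralD.
Qed.

Lemma circle_integralZ c f : circle_integrable f ->
  circle_integral (fun z => c * f z) = c * circle_integral f.
Proof.
move=> [f1 f2]; rewrite /circle_integral.
under eq_Rintegral do rewrite ReM.
under [X in _ +i* X]eq_Rintegral do rewrite ImM.
have iZ (r : R) (u : R -> R) :
    (angle_measure R).-integrable setT (EFin \o u) ->
    (angle_measure R).-integrable setT (EFin \o (fun t => r * u t)).
  exact: integrableZl.
rewrite !RintegralD ?RintegralZl //; try exact: iZ.
by apply/eqP; rewrite eq_complex ReM ImM /= !eqxx.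
Qed.

Lemma circle_integral_sum n (c : nat -> R[i]) (g : nat -> circle R -> R[i]) :
  (forall k, circle_integrable (g k)) ->
  circle_integral (fun z => \sum_(k < n) c k * g k z) =
  \sum_(k < n) c k * circle_integral (g k).
Proof.
move=> ig; suff [] : circle_integral (fun z => \sum_(k < n) c k * g k z) =
  \sum_(k < n) c k * circle_integral (g k) /\
  circle_integrable (fun z => \sum_(k < n) c k * g k z) by [].
elim: n => [|n [ih1 ih2]].
  have e : (fun z => \sum_(k < 0) c k * g k z) = (fun z => 0 * g 0%N z).
    by apply/funext => z; rewrite big_ord0 mul0r.
  rewrite e; split; last exact: circle_integrableZ.
  by rewrite circle_integralZ // mul0r big_ord0.
have e : (fun z => \sum_(k < n.+1) c k * g k z) =
    (fun z => (\sum_(k < n) c k * g k z) + c n * g n z).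
  by apply/funext => z; rewrite big_ord_recr.
rewrite e; split; last by apply: circle_integrableD => //; exact: circle_integrableZ.
rewrite circle_integralD //; last exact: circle_integrableZ.
by rewrite ih1 circle_integralZ // big_ord_recr.
Qed.

Lemma measurable_expi_inv k :
  measurable_fun setT (fun t : R => complex.Re ((sval (expi t))^-1 ^+ k)) /\
  measurable_fun setT (fun t : R => complex.Im ((sval (expi t))^-1 ^+ k)).
Proof.
have inv t : (sval (expi t))^-1 = cos t +i* - sin t.
  rewrite invc_norm (eqP (svalP (expi t))) expr1n invr1 mul1r; by [].
have mc : measurable_fun setT (@cos R).
  by apply: continuous_measurable_fun; exact: continuous_cos.
have ms : measurable_fun setT (@sin R).
  by apply: continuous_measurable_fun; exact: continuous_sin.
elim: k => [|k [ih1 ih2]].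
  by split; exact: measurable_cst.
split.
  rewrite (_ : (fun t : R => _) = (fun t =>
      cos t * complex.Re ((sval (expi t))^-1 ^+ k) +
      sin t * complex.Im ((sval (expi t))^-1 ^+ k))).
    exact: measurable_funD (measurable_funM mc ih1) (measurable_funM ms ih2).
  by apply/funext => t; rewrite exprS ReM inv /= opprK.
rewrite (_ : (fun t : R => _) = (fun t =>
    cos t * complex.Im ((sval (expi t))^-1 ^+ k) -
    sin t * complex.Re ((sval (expi t))^-1 ^+ k))).
  exact: measurable_funB (measurable_funM mc ih2) (measurable_funM ms ih1).
by apply/funext => t; rewrite exprS ImM inv /= mulNr.
Qed.

Lemma circle_integrable_fourier f (k : nat) : circle_integrable f ->
  circle_integrable (fun z => f z * sval z ^ (- k%:Z)).
Proof.
move=> [f1 f2].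
have [m1 m2] := measurable_expi_inv k.
have n1 (t : R) : `|(sval (expi t))^-1 ^+ k| = 1.
  by rewrite normrX normfV (eqP (svalP (expi t))) invr1 expr1n.
have b1 : [bounded complex.Re ((sval (expi t))^-1 ^+ k) | t in [set: R]].
  exists 1; split => // x x1 t _ /=; rewrite -lecR.
  apply: (le_trans (normc_ge_Re _)); rewrite n1 -(rmorph1 (real_complex R)) lecR.
  exact: ltW.
have normc_ge_Im (x : R[i]) : `|complex.Im x|%:C <= `|x|.
  by case: x => a b; rewrite normc_def /= lecR -sqrtr_sqr ler_wsqrtr // lerDr sqr_ge0.
have b2 : [bounded complex.Im ((sval (expi t))^-1 ^+ k) | t in [set: R]].
  exists 1; split => // x x1 t _ /=; rewrite -lecR.
  apply: (le_trans (normc_ge_Im _)); rewrite n1 -(rmorph1 (real_complex R)) lecR.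
  exact: ltW.
have e z : sval z ^ (- k%:Z) = (sval z)^-1 ^+ k by rewrite exprVn -exprnN.
split.
  under eq_fun do rewrite e ReM EFinD mulNr EFinN !EFinM.
  apply: integrableB => //; exact: integrableMl.
under eq_fun do rewrite e ImM EFinD !EFinM.
by apply: integrableD => //; exact: integrableMl.
Qed.

End CircleFourier.

(** * The Besov blocks *)

Section BesovBlocks.
Variable R : realType.
Implicit Types (f : circle R -> R[i]) (z : circle R).

(* Chosen so that the blocks [f * W_n] telescope. *)
Definition besov_cutoff (x : R) : R :=
  if x <= 1 then 1 else if x <= 2 then 2 - x else 0.

Lemma besov_w_cutoff x : besov_w x = besov_cutoff x - besov_cutoff (2 * x).
Proof.
rewrite /besov_w /besov_cutoff.
do ![case: ifP => //= | move=> /andP[] | move=> /negbT];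
  rewrite ?negb_and -?ltNge => *; try lra.
Qed.

Lemma besov_cutoff_ge0 x : 0 <= besov_cutoff x.
Proof. by rewrite /besov_cutoff; do ![case: ifP => /=] => *; lra. Qed.

Lemma besov_cutoff_le1 x : besov_cutoff x <= 1.
Proof.
by rewrite /besov_cutoff; case: (leP x 1) => // x1; case: (leP x 2) => x2; lra.
Qed.

Lemma besov_cutoff1 x : x <= 1 -> besov_cutoff x = 1.
Proof. by rewrite /besov_cutoff => ->. Qed.

Lemma besov_cutoff0 x : 2 <= x -> besov_cutoff x = 0.
Proof.
move=> x2; rewrite /besov_cutoff; case: (leP x 1) => x1; first lra.
by case: (leP x 2) => x3 //; lra.
Qed.

(** De la Vallee-Poussin type sums: the Fourier coefficients are kept up to index 2^J and damped
    linearly to zero at 2^(J+1). *)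
Definition besov_partial f (J : nat) : {poly R[i]} :=
  \poly_(k < 2 ^ J.+1) ((besov_cutoff (k%:R / 2 ^+ J))%:C * fourier f k%:Z).

Lemma exp2_gt0 n : 0 < 2 ^+ n :> R.
Proof. by rewrite exprn_gt0. Qed.

Lemma coef_besov_partial f J k :
  (besov_partial f J)`_k = (besov_cutoff (k%:R / 2 ^+ J))%:C * fourier f k%:Z.
Proof.
rewrite coef_poly; case: ltnP => // kJ; rewrite besov_cutoff0 ?mul0r //.
by rewrite ler_pdivlMr ?exp2_gt0 // -exprS -natrX ler_nat.
Qed.

Lemma size_besov_partial f J : (size (besov_partial f J) <= 2 ^ J.+1)%N.
Proof. exact: size_poly. Qed.

(** The index is shifted: this is f * W_(n+1), with spectrum in ]2^n, 2^(n+2)[, so that N = 2^n in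
    the estimates for blocks. *)
Definition besov_block f n := besov_partial f n.+1 - besov_partial f n.

Lemma size_besov_block f n : (size (besov_block f n) <= 2 ^ n.+2)%N.
Proof.
apply: (leq_trans (size_polyD _ _)); rewrite size_polyN geq_max size_besov_partial.
by apply: (leq_trans (size_besov_partial _ _)); rewrite leq_exp2l.
Qed.

Lemma coef_besov_block f n k :
  (besov_block f n)`_k = (besov_w (k%:R / 2 ^+ n.+1))%:C * fourier f k%:Z.
Proof.
rewrite coefB !coef_besov_partial -mulrBl -rmorphB besov_w_cutoff.
congr ((_ - besov_cutoff _)%:C * _); rewrite exprS.
by field; rewrite gt_eqF ?exp2_gt0.
Qed.

Lemma coef_besov_block_eq0 f n k : (k <= 2 ^ n)%N -> (besov_block f n)`_k = 0.
Proof.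
move=> kn; rewrite coefB !coef_besov_partial !besov_cutoff1 ?subrr //.
  by rewrite ler_pdivrMr ?exp2_gt0 // mul1r -natrX ler_nat.
rewrite ler_pdivrMr ?exp2_gt0 // mul1r -natrX ler_nat (leq_trans kn) //.
by rewrite leq_exp2l.
Qed.

Lemma besov_W_poly n (u : R[i]) :
  besov_W n.+1 u =
  \sum_(k < 2 ^ n.+2) (besov_w (k%:R / 2 ^+ n.+1))%:C * u ^+ k.
Proof.
rewrite /besov_W.
rewrite -(fsbig_widen [set` [seq Posz i | i <- iota 0 (2 ^ n.+2)]] [set: int])
  //; last first.
  move=> k /= [_ nk].
  suff -> : besov_w (k%:~R / 2 ^+ n.+1) = 0 :> R by rewrite mul0r.
  rewrite besov_w_cutoff; case: k nk => k nk.
    have h : 2 <= k%:R / 2 ^+ n.+1 :> R.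
      rewrite ler_pdivlMr ?exp2_gt0 // -exprS -natrX ler_nat leqNgt.
      apply/negP => kn; apply: nk; rewrite map_f // mem_iota //.
    by rewrite !besov_cutoff0 ?subrr //; lra.
  have h : (Negz k)%:~R / 2 ^+ n.+1 <= 0 :> R.
    rewrite ler_pdivrMr ?exp2_gt0 // mul0r NegzE rmorphN oppr_le0 /=.
    exact: ler0n.
  by rewrite !besov_cutoff1 ?subrr //; lra.
rewrite -fsbig_seq; last by rewrite map_inj_uniq ?iota_uniq // => i j [].
by rewrite big_map -[RHS](big_mkord xpredT
  (fun k => (besov_w (k%:R / 2 ^+ n.+1))%:C * u ^+ k)) /index_iota subn0.
Qed.

Lemma circle_conv_besov_block f n z : circle_integrable f ->
  circle_conv f (besov_W n.+1) z = (besov_block f n).[sval z].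
Proof.
move=> cf; rewrite /circle_conv.
rewrite (_ : (fun w => _) = fun w : circle R => \sum_(k < 2 ^ n.+2)
  ((besov_w (k%:R / 2 ^+ n.+1))%:C * sval z ^+ k) *
  (f w * sval w ^ (- k%:Z))); last first.
  apply/funext => w; rewrite besov_W_poly mulr_sumr; apply: eq_bigr => k _.
  rewrite exprMn exprVn -exprnN; ring.
rewrite (circle_integral_sum _ (fun k => (besov_w (k%:R / 2 ^+ n.+1))%:C * sval z ^+ k)
  (g := fun k w => f w * sval w ^ (- k%:Z))); last first.
  by move=> k; exact: circle_integrable_fourier.
rewrite (horner_coef_wide _ (size_besov_block f n)); apply: eq_bigr => k _.
by rewrite coef_besov_block /fourier mulrAC.
Qed.

End BesovBlocks.

(** * From essential to pointwise bounds on the circle *)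

Section SupNorm.
Variable R : realType.

Lemma circle_angle (z : R[i]) : `|z| = 1 ->
  exists2 t : R, 0 <= t <= pi *+ 2 & sval (expi t) = z.
Proof.
case: z => x y; rewrite normc_def /= => -[] h.
have xy : x ^+ 2 + y ^+ 2 = 1.
  by rewrite -(sqr_sqrtr (_ : 0 <= x ^+ 2 + y ^+ 2)) ?addr_ge0 ?sqr_ge0 // h expr1n.
have x1 : -1 <= x <= 1.
  by rewrite -ler_norml -(@ler_sqr _ `|x|) ?nnegrE // expr1n real_normK
    ?num_real // -xy lerDl sqr_ge0.
have pi0 := pi_gt0 R.
have y2 : Num.sqrt (1 - x ^+ 2) = `|y| by rewrite -xy addrC addKr sqrtr_sqr.
have [a0 api] := (acos_ge0 x1, acos_lepi x1).
have [y0|y0] := leP 0 y.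
  exists (acos x); first by apply/andP; split => //; rewrite mulr2n; lra.
  by rewrite /= acosK ?in_itv //= sin_acos // y2 ger0_norm.
exists (pi *+ 2 - acos x); first by apply/andP; rewrite mulr2n; split; lra.
rewrite /= cosB sinB cos2pi sin2pi acosK ?in_itv //= sin_acos // y2 ltr0_norm //.
by congr (_ +i* _); ring.
Qed.

Lemma continuous_expi : continuous (fun t : R => sval (expi t)).
Proof.
apply: near_continuous => t e e0.
have eR : e = (complex.Re e)%:C by rewrite RRe_real // gtr0_real.
have e20 : 0 < complex.Re e / 2 by rewrite divr_gt0 // -ltcR -eR.
have /cvgrPdist_le/(_ _ e20) c := @continuous_cos R t.
have /cvgrPdist_le/(_ _ e20) s := @continuous_sin R t.
apply: filterS2 c s => u cu su.
rewrite /=; apply: (le_trans (normC_le_ReIm _ _)).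
by rewrite eR lecR [X in _ <= X](splitr (complex.Re e)) lerD.
Qed.

(** If u t > M, continuity gives u > M on a nondegenerate interval around t, cut down to [0, 2 pi]
    where the angle law has positive density; such an interval is not negligible. *)
Lemma ae_angle_le (u : R -> R) (M t : R) : continuous u ->
  (\forall s \ae angle_measure R, u s <= M) -> 0 <= t <= pi *+ 2 -> u t <= M.
Proof.
move=> cu ae /andP[t0 t2]; rewrite leNgt; apply/negP => Mt.
have e0 : 0 < (u t - M) / 2 by rewrite divr_gt0 // subr_gt0.
have /cvgrPdist_le/(_ _ e0)/nbhs_ballP[d /= d0 hd] := cu t.
have pi0 := pi_gt0 R.
have [a [b [ab a0 b2 abd]]] : exists a b, [/\ a < b, 0 <= a, b <= pi *+ 2 &
    forall s, a <= s <= b -> `|t - s| < d].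
  exists (Num.max 0 (t - d / 2)), (Num.min (pi *+ 2) (t + d / 2)); split.
  - rewrite lt_min !gt_max mulr2n; apply/andP; split; apply/andP; split; lra.
  - by rewrite le_max lexx.
  - by rewrite ge_min lexx.
  - move=> s; rewrite ge_max le_min => /andP[/andP[_ h1] /andP[_ h2]].
    by rewrite ltr_norml; apply/andP; split; lra.
have ni : ~~ (angle_measure R `[a, b]%classic <= 0)%E.
  rewrite /angle_measure /= /uniform_prob.
  rewrite (eq_integral (fun=> ((pi *+ 2 - 0 : R)^-1)%:E)); last first.
    move=> x; rewrite inE /= in_itv /= => /andP[ax xb].
    by rewrite /uniform_pdf (le_trans a0 ax) (le_trans xb b2).
  rewrite integral_cst //= lebesgue_measure_itv /= lte_fin ab -EFinD -EFinM.
  rewrite lee_fin -ltNge mulr_gt0 ?subr_gt0 // invr_gt0 subr0.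
  exact: pi2_gt0.
case: ae => N [mN N0 sN]; move: ni; apply/negP/negPn.
rewrite -N0; apply: le_measure; rewrite ?inE //.
move=> s; rewrite /= in_itv /= => /abd sd; apply: sN => /=.
apply/negP; rewrite -ltNge.
have := hd s; rewrite -ball_normE /ball_ /= => /(_ sd); rewrite ler_norml => /andP[_].
lra.
Qed.

Lemma circle_Lnorm_poly (p : {poly R[i]}) (M : R) :
  (circle_Lnorm +oo (fun z => p.[sval z]) <= M%:E)%E ->
  forall z, `|z| = 1 -> `|p.[z]| <= M%:C.
Proof.
rewrite /circle_Lnorm unlock [X in (0 < X)%E](_ : _ = 1%E); last first.
  exact: probability_setT.
rewrite lte01 => h z /circle_angle[t t2 <-].
rewrite -Re_normC lecR.
pose u s := complex.Re `|p.[sval (expi s)]|.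
apply: (@ae_angle_le u) t2.
  apply: near_continuous => s e e0.
  have h1 := near_norm_horner p (sval (expi s)) e0.
  exact: (continuous_expi h1).
have := ess_sup_ge (angle_measure R) (abse \o (fun s => (u s)%:E)).
apply: filterS => s /le_trans/(_ h); rewrite /= lee_fin.
by apply: le_trans; exact: ler_norm.
Qed.

End SupNorm.

(** * Summability of Fourier coefficients and uniform approximation of the extension *)

Section AnalyticExtension.
Variable R : realType.
Variable f : circle R -> R[i].
Hypothesis hf : besov_plus 1 +oo%E 1%E f.

(** For q = 1 the Besov condition is the summability of 2^n ||f * W_n||. The bound [M n] is the norm
    for W_(n+1), so the weight 2^(n+1) is weakened to 2^n and the nonnegative term of W_0 is
    dropped. *)
Lemma besov_block_bound : exists (M : nat -> R) (C : R),
  [/\ forall n, 0 <= M n, forall n, \sum_(k < n) 2 ^+ k * M k <= C &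
      forall n z, `|z| = 1 -> `|(besov_block f n).[z]| <= (M n)%:C].
Proof.
have [[cf hW _] _] := hf.
pose L n := circle_Lnorm +oo (circle_conv f (besov_W n)).
have L0 n : (0 <= L n)%E by exact: Lnorm_ge0.
pose a n : \bar R := ((2 `^ (n%:R * 1))%:E * L n)%E.
have a0 n : (0 <= a n)%E by rewrite mule_ge0 // lee_fin powR_ge0.
have sa : (\sum_(0 <= k <oo) a k < +oo)%E.
  move: hW; rewrite Lnorm1 ge0_integral_count //.
  rewrite (eq_eseriesr (g := a)) // => k _.
  by rewrite gee0_abs //; exact: a0.
have le n : (\sum_(k < n) a k <= \sum_(0 <= k <oo) a k)%E.
  by rewrite -(big_mkord xpredT) nneseries_lim_ge.
have tot0 : (0 <= \sum_(0 <= k <oo) a k)%E by exact: nneseries_ge0.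
have afin n : a n \is a fin_num.
  rewrite ge0_fin_numE //; apply: le_lt_trans sa; apply: le_trans (le n.+1).
  by rewrite big_ord_recr /= leeDr //; apply: sume_ge0 => k _; exact: a0.
have Lfin n : L n \is a fin_num.
  move: (afin n); rewrite /a; case: (L n) (L0 n) => //= _.
  by rewrite mulry gtr0_sg ?powR_gt0 // mul1e.
exists (fun n => fine (L n.+1)), (fine (\sum_(0 <= k <oo) a k)); split.
- by move=> n; rewrite fine_ge0.
- move=> n; rewrite -lee_fin fineK ?ge0_fin_numE // (le_trans _ (le n.+1)) //.
  rewrite big_ord_recl /= -sumEFin -[X in (X <= _)%E]add0e.
  apply: leeD => //; apply: lee_sum => k _.
  rewrite /a EFinM fineK // lee_wpmul2r // lee_fin mulr1 powR_mulrn //.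
  by rewrite /bump leq0n add1n ler_weXn2l ?ler1n.
- move=> n z z1; apply: circle_Lnorm_poly z1; rewrite fineK //.
  rewrite /L (_ : circle_conv f _ = fun z => (besov_block f n).[sval z]) //.
  by apply/funext => w; exact: circle_conv_besov_block.
Qed.

Lemma besov_partialE J :
  besov_partial f J = besov_partial f 0 + \sum_(n < J) besov_block f n.
Proof.
elim: J => [|J ih]; first by rewrite big_ord0 addr0.
by rewrite big_ord_recr /= addrA -ih /besov_block addrC subrK.
Qed.

(** With a = b = 1 the trapezoidal multiplier is the indicator of one index, and the constant (a +
    b) / 2 is 1. *)
Lemma coef_le_circle (p : {poly R[i]}) (M : R[i]) k :
  (forall z, `|z| = 1 -> `|p.[z]| <= M) -> `|p`_k| <= M.
Proof.
move=> pM; have M0 : 0 <= M by exact: le_trans (normr_ge0 _) (pM 1 (normr1 _)).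
have [sk|ks] := leqP (size p) k; first by rewrite nth_default // normr0.
have := trapezoid_multiplier 1 1 k 0 pM (normr1 _).
have -> : \sum_(m < size p) (\sum_(l < 1) \sum_(k0 < 1)
    ((m + 0)%N == (l + k0 + k)%N)%:R) * (p`_m * 1 ^+ m) = p`_k.
  rewrite (bigD1 (Ordinal ks)) //= [X in _ + X]big1 => [|m mk].
    by rewrite !big_ord1 addn0 !add0n eqxx mul1r expr1n mulr1 addr0.
  rewrite !big_ord1 addn0 !add0n; case: eqP => [e|_]; last by rewrite mul0r.
  by case/eqP: mk; exact: val_inj.
by rewrite divff ?pnatr_eq0 // mulr1.
Qed.

Lemma sum_coef_le (p : {poly R[i]}) (M : R) N K : (size p <= N)%N ->
  (forall z, `|z| = 1 -> `|p.[z]| <= M%:C) ->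
  \sum_(k < K) `|p`_k| <= (N%:R * M)%:C.
Proof.
move=> pN pM.
have M0 : 0 <= M.
  by rewrite -lecR; exact: le_trans (normr_ge0 _) (pM 1 (normr1 _)).
apply: (@le_trans _ _ (\sum_(k < N) `|p`_k|)).
  rewrite -(big_mkord xpredT (fun k => `|p`_k|)) -(big_mkord xpredT (fun k => `|p`_k|)).
  have [KN|NK] := leqP K N.
    by rewrite (big_cat_nat _ KN) //= lerDl sumr_ge0.
  rewrite (big_cat_nat _ (ltnW NK)) //= [X in _ + X](_ : _ = 0) ?addr0 //.
  rewrite big_nat_cond big1 // => k /andP[/andP[Nk _] _].
  by rewrite nth_default ?normr0 // (leq_trans pN).
apply: (@le_trans _ _ (\sum_(k < N) M%:C)).
  by apply: ler_sum => k _; exact: coef_le_circle.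
by rewrite sumr_const card_ord mulr_natl rmorphMn.
Qed.

(** Block n has at most 2^(n+2) coefficients, each at most [M n], and sum_n 2^n M n converges. *)
Lemma fourier_summable : cvgn (series (fun k => complex.Re `|fourier f k%:Z|)).
Proof.
have [M [C [M0 MC bM]]] := besov_block_bound.
pose D := complex.Re (\sum_(k < 2) `|(besov_partial f 0)`_k|).
have DE : D%:C = \sum_(k < 2) `|(besov_partial f 0)`_k|.
  by rewrite /D RRe_real // ger0_real // sumr_ge0.
apply: nondecreasing_is_cvgn.
  apply: nondecreasing_series => n _ _; rewrite -lecR Re_normC; exact: normr_ge0.
exists (D + 4 * C) => _ [K _ <-]; rewrite seriesEord -lecR.
have -> : (\sum_(k < K) complex.Re `|fourier f k%:Z|)%:C =
    \sum_(k < K) `|fourier f k%:Z|.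
  by rewrite rmorph_sum; apply: eq_bigr => k _; exact: Re_normC.
(* For k < K the cutoff at level K equals 1, because k <= 2^K; so the Fourier coefficient is the sum
   of those of the blocks. *)
have aE (k : 'I_K) : `|fourier f k%:Z| <=
    `|(besov_partial f 0)`_k| + \sum_(n < K) `|(besov_block f n)`_k|.
  have -> : fourier f k%:Z = (besov_partial f K)`_k.
    rewrite coef_besov_partial besov_cutoff1 ?mul1r //.
    rewrite ler_pdivrMr ?exp2_gt0 // mul1r -natrX ler_nat.
    by apply: leq_trans (ltnW (ltn_ord k)) (ltnW (ltn_expl _ _)).
  rewrite besov_partialE coefD coef_sum.
  by apply: (le_trans (ler_normD _ _)); rewrite lerD2l ler_norm_sum.
apply: (le_trans (ler_sum _ (fun k _ => aE k))).
rewrite big_split /= exchange_big /= rmorphD lerD //=.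
  rewrite DE -(big_mkord xpredT (fun k => `|(besov_partial f 0)`_k|)).
  rewrite -(big_mkord xpredT (fun k => `|(besov_partial f 0)`_k|)).
  have [K2|K2] := leqP K 2; first by rewrite (big_cat_nat _ K2) //= lerDl sumr_ge0.
  rewrite (big_cat_nat _ (ltnW K2)) //= [X in _ + X](_ : _ = 0) ?addr0 //.
  rewrite big_nat_cond big1 // => k /andP[/andP[Nk _] _].
  rewrite nth_default ?normr0 //.
  exact: (leq_trans (size_besov_partial f 0)).
apply: (@le_trans _ _ (\sum_(n < K) ((2 ^ n.+2)%:R * M n)%:C)).
  apply: ler_sum => n _; apply: sum_coef_le (bM n); exact: size_besov_block.
rewrite -rmorph_sum lecR; apply: (@le_trans _ _ (4 * \sum_(n < K) 2 ^+ n * M n)).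
  rewrite mulr_sumr; apply: ler_sum => n _; rewrite natrX !exprS; lra.
by rewrite ler_pM2l.
Qed.

Lemma normC_series_cvg (u : nat -> R[i]) (b : nat -> R) :
  (forall n, `|u n| <= (b n)%:C) -> cvgn (series b) ->
  exists l : R[i], series u @ \oo --> l.
Proof.
move=> ub cb.
have b0 n : 0 <= b n by rewrite -lecR; exact: le_trans (normr_ge0 _) (ub n).
have cR (g : R[i] -> R) : (forall w, `|g w|%:C <= `|w|) ->
    cvgn (series (fun n => g (u n))).
  move=> gw; apply: normed_cvg; apply: series_le_cvg cb => // n.
    exact: normr_ge0.
  by rewrite -lecR; exact: le_trans (gw _) (ub n).
have ImW (x : R[i]) : `|complex.Im x|%:C <= `|x|.
  by case: x => p q; rewrite normc_def /= lecR -sqrtr_sqr ler_wsqrtr // lerDr sqr_ge0.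
have /cvg_ex[x cx] := cR _ (@normc_ge_Re R).
have /cvg_ex[y cy] := cR _ ImW.
exists (x +i* y); apply/cvgrPdist_le => e e0.
have eR : e = (complex.Re e)%:C by rewrite RRe_real // gtr0_real.
have e20 : 0 < complex.Re e / 2 by rewrite divr_gt0 // -ltcR -eR.
move/cvgrPdist_le/(_ _ e20) : cx => cx.
move/cvgrPdist_le/(_ _ e20) : cy => cy.
apply: filterS2 cx cy => n hx hy.
have -> : series u n = series (fun n => complex.Re (u n)) n +i*
    series (fun n => complex.Im (u n)) n.
  rewrite !seriesEord /=; elim: (n) => [|m ih]; first by rewrite !big_ord0.
  by rewrite !big_ord_recr /= ih; case: (u m).
apply: (le_trans (normC_le_ReIm _ _)).
by rewrite eR lecR [X in _ <= X](splitr (complex.Re e)) lerD.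
Qed.

(** Coefficients below 2^J agree and each later one changes by at most its own modulus, the cutoff
    being in [0, 1]; the error is a tail of the summable coefficients, uniformly in z. *)
Lemma analytic_extension_approx (e : R[i]) : 0 < e ->
  \forall J \near \oo, forall z, closed_disk R z ->
    `|(besov_partial f J).[z] - analytic_extension f z| <= e.
Proof.
move=> e0; have eR : e = (complex.Re e)%:C by rewrite RRe_real // gtr0_real.
have e0' : 0 < complex.Re e by rewrite -ltcR -eR.
have a0 n : 0 <= complex.Re `|fourier f n%:Z|.
  by rewrite -lecR Re_normC; exact: normr_ge0.
have [N _ tail] := series_tail_le a0 fourier_summable e0'.
exists N => // J /= NJ z z1.
have zk k : `|z ^+ k| <= 1 by rewrite normrX exprn_ile1.
have [l cl] : exists l : R[i],
    series (fun k : nat => fourier f k%:Z * z ^+ k) @ \oo --> l.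
  apply: normC_series_cvg fourier_summable => n.
  by rewrite normrM Re_normC ler_piMr.
have -> : analytic_extension f z = l by apply: cvg_lim cl.
apply/ler_addgt0Pr => d d0.
move/cvgrPdist_le/(_ _ d0) : cl => cl.
have [K [JK hK]] := filter_ex (filterI (nbhs_infty_ge (2 ^ J.+1)) cl).
apply: (le_trans (ler_distD (series (fun k : nat => fourier f k%:Z * z ^+ k) K) _ _)).
apply: lerD; last by rewrite distrC.
rewrite distrC (horner_coef_wide _ (leq_trans (size_besov_partial f J) JK)).
rewrite seriesEord /= -sumrB.
have J1 : (2 ^ J <= K)%N by apply: leq_trans JK; rewrite leq_exp2l.
have term k : `|fourier f k%:Z * z ^+ k - (besov_partial f J)`_k * z ^+ k| <=
   (if (k < 2 ^ J)%N then 0 else `|fourier f k%:Z|).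
  rewrite coef_besov_partial -mulrBl -{1}[fourier f _]mul1r -mulrBl !normrM.
  case: ltnP => kJ.
    rewrite besov_cutoff1 ?subrr ?normr0 ?mul0r //.
    by rewrite ler_pdivrMr ?exp2_gt0 // mul1r -natrX ler_nat ltnW.
  rewrite -[X in _ <= X]mulr1; apply: ler_pM => //.
  rewrite ler_piMl // -(rmorph1 (real_complex R)) -rmorphB normC_real lecR.
  by rewrite ger0_norm ?subr_ge0 ?besov_cutoff_le1 // lerBlDr lerDl besov_cutoff_ge0.
apply: (le_trans (ler_norm_sum _ _ _)).
apply: (@le_trans _ _
    (\sum_(k < K) (if (k < 2 ^ J)%N then 0 else `|fourier f k%:Z|))).
  by apply: ler_sum => k _; exact: term.
rewrite -(big_mkord xpredT (fun k => if (k < 2 ^ J)%N then 0 else `|fourier f k%:Z|)).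
rewrite (big_cat_nat _ J1) //= [X in X + _](_ : _ = 0) ?add0r; last first.
  by rewrite big_nat_cond big1 // => k /andP[/andP[_ ->]].
have -> : \sum_(2 ^ J <= k < K) (if (k < 2 ^ J)%N then 0 else `|fourier f k%:Z|) =
    (\sum_(2 ^ J <= k < K) complex.Re `|fourier f k%:Z|)%:C.
  rewrite rmorph_sum; apply: eq_big_nat => k /andP[Jk _].
  by rewrite ltnNge Jk; symmetry; exact: Re_normC.
by rewrite eR lecR; apply: tail => /=; apply: leq_trans NJ (ltnW (ltn_expl _ _)).
Qed.

End AnalyticExtension.

(** * The divided difference of a block *)

Section BlockDecomposition.
Variable R : realType.
Implicit Types (p q : {poly R[i]}) (N : nat).

(* [2 * N] times the function alpha described at the top of the file; [j] is
   the exponent of z. *)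
Definition ramp N k j : nat := \sum_(l < 2 * N) (l + k < j + N)%N.

(** The reversal l -> 2 N - 1 - l turns the condition counted by one ramp into the negation of that
    counted by the other. *)
Lemma ramp_sym N k j : (ramp N k j + ramp N j k = 2 * N)%N.
Proof.
rewrite /ramp (reindex_inj rev_ord_inj) /= -big_split /=.
rewrite (eq_bigr (fun=> 1%N)); first by rewrite sum1_card card_ord.
by move=> l _; have := ltn_ord l; lia.
Qed.

(** The polynomial sum_j alpha(j, k) b_(j+k+1) z^j paired with w^k; with the variables exchanged it
    is also the factor paired with z^k. *)
Definition ramp_poly N p k : {poly R[i]} :=
  \poly_(j < 4 * N) ((ramp N k j)%:R / (2 * N)%:R * p`_(j + k).+1).

(** On the circle, multiplication by z^(k+1) turns this polynomial into a multiplier applied to p,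
    with m = j + k + 1. Its rise has length 2 N, and the side 5 N makes the plateau outlast all
    degrees below 4 N, so only the rising half of the trapezoid is seen. The shift [N] on the left
    avoids a subtraction. *)
Lemma ramp_poly_le N p (M : R[i]) k z : (0 < N)%N ->
  (forall m, (m <= N)%N -> p`_m = 0) -> (size p <= 4 * N)%N ->
  (forall z, `|z| = 1 -> `|p.[z]| <= M) -> `|z| <= 1 ->
  `|(ramp_poly N p k).[z]| <= 2 * M.
Proof.
move=> N0 pN sp pM; move: z; apply: poly_maximum_principle => z z1.
have M0 : 0 <= M by exact: le_trans (normr_ge0 _) (pM 1 (normr1 _)).
have := trapezoid_multiplier (2 * N) (5 * N) (2 * k + 2) N pM z1.
have -> : \sum_(m < size p) (\sum_(l < 2 * N) \sum_(i < 5 * N)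
    ((m + N)%N == (l + i + (2 * k + 2))%N)%:R) * (p`_m * z ^+ m) =
    \sum_(j < 4 * N) (ramp N k j)%:R * (p`_(j + k).+1 * z ^+ (j + k).+1).
  have term m : (\sum_(l < 2 * N) \sum_(i < 5 * N)
    ((m + N)%N == (l + i + (2 * k + 2))%N)%:R) * (p`_m * z ^+ m) =
    (if (k < m)%N then (ramp N k (m - k.+1))%:R else 0) * (p`_m * z ^+ m).
    have [mN|Nm] := leqP m N; first by rewrite pN // mul0r !mulr0.
    have [ms|sm] := leqP (size p) m; first by rewrite nth_default // mul0r !mulr0.
    congr (_ * _).
    have cnt (l : 'I_(2 * N)) : \sum_(i < 5 * N)
        ((m + N)%N == (l + i + (2 * k + 2))%N)%:R =
        (l + (2 * k + 2) <= m + N)%N%:R :> R[i].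
      have [le|gt] := leqP.
        have h : (m + N - (l + (2 * k + 2)) < 5 * N)%N by lia.
        rewrite (bigD1 (Ordinal h)) //= [X in _ + X]big1 ?addr0.
          by rewrite (_ : (m + N == _)%N) //; lia.
        move=> i ih; case: eqP => // e; case/eqP: ih; apply: val_inj => /=; lia.
      by apply: big1 => i _; case: eqP => //; lia.
    under eq_bigr do rewrite cnt.
    case: ltnP => km.
      rewrite /ramp natr_sum; apply: eq_bigr => l _; congr (nat_of_bool _)%:R.
      by lia.
    (* Here N < m <= k, hence m + N < 2 k + 2: the trapezoid vanishes by itself where j would be
       negative. *)
    by apply: big1 => l _; case: leqP => //; lia.
  under eq_bigr do rewrite term.
  pose G m := (if (k < m)%N then (ramp N k (m - k.+1))%:R else 0) * (p`_m * z ^+ m).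
  rewrite -(big_mkord xpredT G).
  have -> : \sum_(0 <= m < size p) G m = \sum_(0 <= m < 4 * N + k.+1) G m.
    have le : (size p <= 4 * N + k.+1)%N by lia.
    rewrite [RHS](big_cat_nat _ le) //= [X in _ = _ + X](_ : _ = 0) ?addr0 //.
    rewrite big_nat_cond big1 // => m /andP[/andP[h _] _].
    by rewrite /G nth_default // mul0r mulr0.
  have le : (k.+1 <= 4 * N + k.+1)%N by lia.
  rewrite (big_cat_nat _ le) //= [X in X + _](_ : _ = 0) ?add0r; last first.
    rewrite big_nat_cond big1 // => m /andP[/andP[_ h] _].
    by rewrite /G ltnNge -ltnS h mul0r.
  rewrite -{1}[k.+1]add0n big_addn addnK big_mkord; apply: eq_bigr => j _.
  by rewrite /G addnS ltnS leq_addl subSS addnK.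
move=> h.
have N2 : (0 : R[i]) < (2 * N)%:R by rewrite ltr0n; lia.
have e : z ^+ k.+1 * (ramp_poly N p k).[z] = (2 * N)%:R^-1 *
    \sum_(j < 4 * N) (ramp N k j)%:R * (p`_(j + k).+1 * z ^+ (j + k).+1).
  rewrite (horner_coef_wide _ (size_poly _ _)) !mulr_sumr.
  apply: eq_bigr => j _; rewrite coef_poly ltn_ord -addnS exprD; ring.
have -> : `|(ramp_poly N p k).[z]| = `|z ^+ k.+1 * (ramp_poly N p k).[z]|.
  by rewrite normrM normrX z1 expr1n mul1r.
rewrite e normrM normfV normr_nat ler_pdivrMl //; apply: (le_trans h).
rewrite mulrC [(2 * N)%:R * _]mulrCA mulrA [X in _ <= X]mulrC.
(* The multiplier bound (2 N + 5 N) / 2 divided by 2 N is 7 / 4, rounded up to 2. *)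
rewrite [_ * M]mulrC ler_wpM2l // ler_pdivrMr // -!natrM ler_nat; lia.
Qed.

Section Sums.
Variables (V : lmodType R[i]).

Lemma ramp_poly_sum N p (g : nat -> nat -> V) : (0 < N)%N ->
  \sum_(k < 4 * N) \sum_(j < 4 * N) (ramp_poly N p k)`_j *: g j k +
  \sum_(k < 4 * N) \sum_(j < 4 * N) (ramp_poly N p k)`_j *: g k j =
  \sum_(j < 4 * N) \sum_(k < 4 * N) p`_(j + k).+1 *: g j k.
Proof.
move=> N0; rewrite exchange_big -big_split /=; apply: eq_bigr => j _.
rewrite -big_split /=; apply: eq_bigr => k _; rewrite -scalerDl !coef_poly !ltn_ord.
rewrite [(k + j)%N]addnC -mulrDl -mulrDl -natrD ramp_sym divff ?mul1r //.
by rewrite pnatr_eq0; lia.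
Qed.

(** With G j k = p_(j+k) g j k, the sum is that of G shifted in j minus that of G shifted in k.
    Adding the row j = 0 to the first, or the column k = 0 to the second, gives the same full sum,
    since G vanishes for j + k >= n. *)
Lemma telescope_sum n p (g : nat -> nat -> V) : (size p <= n)%N ->
  \sum_(j < n) \sum_(k < n) p`_(j + k).+1 *: (g j.+1 k - g j k.+1) =
  \sum_(m < n) p`_m *: (g m 0%N - g 0%N m).
Proof.
move=> pn; pose G j k := p`_(j + k) *: g j k.
have G0 j k : (n <= j + k)%N -> G j k = 0.
  by move=> h; rewrite /G nth_default ?scale0r // (leq_trans pn).
pose A := \sum_(j < n) \sum_(k < n) G j.+1 k.
pose B := \sum_(j < n) \sum_(k < n) G j k.+1.
have -> : \sum_(j < n) \sum_(k < n) p`_(j + k).+1 *: (g j.+1 k - g j k.+1) = A - B.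
  rewrite /A /B -sumrB; apply: eq_bigr => j _; rewrite -sumrB.
  by apply: eq_bigr => k _; rewrite /G scalerBr addSn addnS.
have eA : \sum_(j < n.+1) \sum_(k < n.+1) G j k = \sum_(k < n) G 0%N k + A.
  rewrite big_ord_recl big_ord_recr /= [G 0%N n]G0 ?addr0 //; congr (_ + _).
  by apply: eq_bigr => j _; rewrite big_ord_recr /= [X in _ + X]G0 ?addr0 // leq_addl.
have eB : \sum_(j < n.+1) \sum_(k < n.+1) G j k = \sum_(j < n) G j 0%N + B.
  rewrite big_ord_recr /= [X in _ + X]big1 ?addr0; last first.
    by move=> k _; apply: G0; rewrite leq_addr.
  by rewrite /B -big_split /=; apply: eq_bigr => j _; rewrite big_ord_recl.
have -> : A - B = \sum_(j < n) G j 0%N - \sum_(k < n) G 0%N k.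
  have -> : A = \sum_(j < n) G j 0%N + B - \sum_(k < n) G 0%N k.
    by rewrite -eB eA addrAC subrr add0r.
  by rewrite addrAC addrK.
rewrite -sumrB; apply: eq_bigr => m _.
by rewrite /G addn0 add0n scalerBr.
Qed.

(** The bilinear extension of z^j (x) w^k -> g j k. Leaving [g] arbitrary serves both the scalars
    z^j w^k and the vectors T^j S^k x. *)
Definition bilinear_eval (g : nat -> nat -> V) p q : V :=
  \sum_(j < size p) \sum_(k < size q) (p`_j * q`_k) *: g j k.

Lemma bilinear_eval_wide g p q m n : (size p <= m)%N -> (size q <= n)%N ->
  bilinear_eval g p q = \sum_(j < m) \sum_(k < n) (p`_j * q`_k) *: g j k.
Proof.
move=> pm qn; rewrite /bilinear_eval.
have w (h : {poly R[i]}) a (G : nat -> V) : (size h <= a)%N ->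
    (forall i, h`_i = 0 -> G i = 0) -> \sum_(i < size h) G i = \sum_(i < a) G i.
  move=> ha h0; rewrite (big_ord_widen _ G ha) big_mkcond /=.
  by apply: eq_bigr => i _; case: ltnP => // hi; rewrite h0 // nth_default.
rewrite (w p m (fun j => \sum_(k < size q) (p`_j * q`_k) *: g j k)) //.
  apply: eq_bigr => j _; apply: (w q n (fun k => (p`_j * q`_k) *: g j k)) => // i ->.
  by rewrite mulr0 scale0r.
by move=> i ->; rewrite big1 // => k _; rewrite mul0r scale0r.
Qed.

Lemma bilinear_eval_Xnr g p n k : (size p <= n)%N ->
  bilinear_eval g p 'X^k = \sum_(j < n) p`_j *: g j k.
Proof.
move=> pn; rewrite (bilinear_eval_wide _ pn (leqnn _)) size_polyXn.
apply: eq_bigr => j _; rewrite big_ord_recr /= coefXn eqxx mulr1 big1 ?add0r //.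
by move=> i _; rewrite coefXn ltn_eqF ?mulr0 ?scale0r.
Qed.

Lemma bilinear_eval_Xnl g p n k : (size p <= n)%N ->
  bilinear_eval g 'X^k p = \sum_(j < n) p`_j *: g k j.
Proof.
move=> pn; rewrite (bilinear_eval_wide _ (leqnn _) pn) size_polyXn.
rewrite big_ord_recr /= big1 ?add0r => [|i _].
  by apply: eq_bigr => j _; rewrite coefXn eqxx mul1r.
by apply: big1 => j _; rewrite coefXn ltn_eqF ?mul0r ?scale0r.
Qed.

End Sums.
End BlockDecomposition.

(** * The tensor representation of the divided difference *)

Section TensorRepresentation.
Variable R : realType.
Variable f : circle R -> R[i].

(* The [2 ^ n.+3] tensors of the [n]-th block get the indices in
   [2 ^ n.+3, 2 ^ n.+4[. *)
Definition block_tensor n r : {poly R[i]} * {poly R[i]} :=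
  let N := (2 ^ n)%N in let p := besov_block f n in
  if (r < 4 * N)%N then (ramp_poly N p r, 'X^r)
  else ('X^(r - 4 * N), ramp_poly N p (r - 4 * N)).

(** Index 0 holds the divided difference of [besov_partial f 0], a constant since its degree is at
    most 1. Indices 1 to 7 are padding, so that a block index is recovered from the binary
    logarithm. *)
Definition tensor m : {poly R[i]} * {poly R[i]} :=
  if m == 0%N then (((besov_partial f 0)`_1)%:P, 1)
  else if (m < 8)%N then (0, 0)
  else let n := trunc_log 2 m in block_tensor (n - 3) (m - 2 ^ n).

(** [F] is arbitrary because the same regrouping is needed for bilinear evaluations and for products
    of norms. *)
Lemma sum_tensor (V : zmodType) (F : {poly R[i]} -> {poly R[i]} -> V) J :
  F 0 0 = 0 ->
  \sum_(0 <= m < 2 ^ (J + 3)) F (tensor m).1 (tensor m).2 =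
  F ((besov_partial f 0)`_1)%:P 1 +
  \sum_(n < J) (\sum_(k < 4 * 2 ^ n)
                  F (ramp_poly (2 ^ n) (besov_block f n) k) 'X^k +
                \sum_(k < 4 * 2 ^ n)
                  F 'X^k (ramp_poly (2 ^ n) (besov_block f n) k)).
Proof.
move=> F0; elim: J => [|J ih].
  rewrite big_ord0 addr0 big_ltn // [X in _ + X](_ : _ = 0) ?addr0 //.
  rewrite big_nat_cond big1 // => m /andP[/andP[m0 m8] _].
  by rewrite /tensor gtn_eqF // m8.
have le : (2 ^ (J + 3) <= 2 ^ (J.+1 + 3))%N by rewrite leq_exp2l // leq_add2r.
rewrite (big_cat_nat _ le) //= ih big_ord_recr /= addrA; congr (_ + _).
rewrite -{1}[(2 ^ (J + 3))%N]add0n big_addn big_mkord.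
have -> : (2 ^ (J.+1 + 3) - 2 ^ (J + 3) = 4 * 2 ^ J + 4 * 2 ^ J)%N.
  rewrite addSn expnS expnD; lia.
have te r : (r < 4 * 2 ^ J + 4 * 2 ^ J)%N ->
    tensor (r + 2 ^ (J + 3))%N = block_tensor J r.
  move=> rJ; have J8 : (8 <= 2 ^ (J + 3))%N.
    by rewrite expnD leq_pmull // expn_gt0.
  rewrite /tensor gtn_eqF; last by lia.
  rewrite ltnNge (leq_trans J8 (leq_addl _ _)) /=.
  have -> : trunc_log 2 (r + 2 ^ (J + 3))%N = (J + 3)%N.
    apply: trunc_log_eq => //; rewrite leq_addl /= expnS mul2n -addnn ltn_add2r.
    by apply: (leq_trans rJ); rewrite expnD; lia.
  by rewrite !addnK.
rewrite big_split_ord /=; congr (_ + _); apply: eq_bigr => k _.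
  by rewrite te /block_tensor /= ?ltn_ord // ltn_addr.
by rewrite te /block_tensor /= ?ltn_add2l // ltnNge leq_addr /= addKn.
Qed.

Section Evaluation.
Variables (V : lmodType R[i]) (g : nat -> nat -> V).

Definition telescope_eval (p : {poly R[i]}) : V :=
  \sum_(m < size p) p`_m *: (g m 0%N - g 0%N m).

Lemma telescope_eval_wide (p : {poly R[i]}) n : (size p <= n)%N ->
  telescope_eval p = \sum_(m < n) p`_m *: (g m 0%N - g 0%N m).
Proof.
move=> pn; rewrite /telescope_eval.
rewrite (big_ord_widen _ (fun m => p`_m *: (g m 0%N - g 0%N m)) pn) big_mkcond.
by apply: eq_bigr => i _; case: ltnP => // h; rewrite nth_default // scale0r.
Qed.

Lemma telescope_evalD p q :
  telescope_eval (p + q) = telescope_eval p + telescope_eval q.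
Proof.
rewrite (telescope_eval_wide (size_polyD p q)).
rewrite (telescope_eval_wide (leq_maxl (size p) (size q))).
rewrite (telescope_eval_wide (leq_maxr (size p) (size q))) -big_split /=.
by apply: eq_bigr => i _; rewrite coefD scalerDl.
Qed.

(** The difference of shifts of [g] is the effect of the factor z - w, or of inserting T - S. This
    one identity gives the scalar divided difference and the operator formula. *)
Lemma bilinear_eval_tensor J :
  \sum_(0 <= m < 2 ^ (J + 3))
     bilinear_eval (fun j k => g j.+1 k - g j k.+1) (tensor m).1 (tensor m).2 =
  telescope_eval (besov_partial f J).
Proof.
rewrite sum_tensor; last first.
  by rewrite /bilinear_eval size_poly0 big_ord0.
elim: J => [|J ih].
  rewrite big_ord0 addr0 (_ : 1 = 'X^0) //.
  rewrite (bilinear_eval_Xnr _ _ (size_polyC_leq1 _)) big_ord1 coefC eqxx.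
  rewrite (telescope_eval_wide (size_besov_partial f 0)) /=.
  by rewrite big_ord_recr big_ord1 /= subrr scaler0 add0r.
rewrite big_ord_recr /= addrA ih.
have -> : besov_partial f J.+1 = besov_partial f J + besov_block f J.
  by rewrite /besov_block addrC subrK.
rewrite telescope_evalD; congr (_ + _).
have s4 : (size (besov_block f J) <= 4 * 2 ^ J)%N.
  by rewrite (leq_trans (size_besov_block f J)) // !expnS; lia.
rewrite (telescope_eval_wide s4) -(telescope_sum g s4).
rewrite -(ramp_poly_sum (besov_block f J)
  (fun j k => g j.+1 k - g j k.+1)) ?expn_gt0 //; congr (_ + _).
  apply: eq_bigr => k _; apply: bilinear_eval_Xnr; exact: size_poly.
apply: eq_bigr => k _; apply: bilinear_eval_Xnl; exact: size_poly.
Qed.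

End Evaluation.

Hypothesis hf : besov_plus 1 +oo%E 1%E f.

Lemma disk_norm_horner_le (p : {poly R[i]}) (M : R) :
  (forall z, `|z| <= 1 -> `|p.[z]| <= M%:C) -> disk_norm (horner p) <= M.
Proof. by move=> h; apply: disk_norm_le. Qed.

Lemma disk_norm_horner_ge0 (p : {poly R[i]}) : 0 <= disk_norm (horner p).
Proof. by apply: disk_norm_ge0; have [] := disk_algebra_poly p. Qed.

(** Block n has two families of 4 * 2^n tensors, each of norm at most 2 M n, hence the total 16 *
    2^n M n. *)
Lemma tensor_summable :
  (\sum_(0 <= m <oo) (disk_norm (horner (tensor m).1) *
     disk_norm (horner (tensor m).2))%:E < +oo)%E.
Proof.
have [M [C [M0 MC bM]]] := besov_block_bound hf.
pose F (p q : {poly R[i]}) := disk_norm (horner p) * disk_norm (horner q).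
have F0 p q : 0 <= F p q by rewrite mulr_ge0 // disk_norm_horner_ge0.
have F00 : F 0 0 = 0.
  have d0 : disk_norm (horner (0 : {poly R[i]})) = 0.
    apply/eqP; rewrite eq_le disk_norm_horner_ge0 andbT.
    by apply: disk_norm_horner_le => z _; rewrite horner0 normr0.
  by rewrite /F d0 mul0r.
have X1 k : disk_norm (horner ('X^k : {poly R[i]})) <= 1.
  apply: disk_norm_horner_le => z z1; rewrite hornerXn normrX rmorph1.
  by rewrite exprn_ile1.
have A2 n k : disk_norm (horner (ramp_poly (2 ^ n) (besov_block f n) k)) <= 2 * M n.
  apply: disk_norm_horner_le => z z1.
  have -> : (2 * M n)%:C = 2 * (M n)%:C :> R[i] by rewrite rmorphM rmorph_nat.
  apply: ramp_poly_le z1; rewrite ?expn_gt0 //.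
  - by move=> m; exact: coef_besov_block_eq0.
  - by rewrite (leq_trans (size_besov_block f n)) // !expnS; lia.
  - exact: bM.
pose c := F ((besov_partial f 0)`_1)%:P 1.
have partial J : \sum_(0 <= m < 2 ^ (J + 3)) F (tensor m).1 (tensor m).2 <= c + 16 * C.
  rewrite sum_tensor // lerD2l.
  apply: (@le_trans _ _ (\sum_(n < J) 16 * (2 ^+ n * M n))).
    apply: ler_sum => n _.
    have h1 : \sum_(k < 4 * 2 ^ n) F (ramp_poly (2 ^ n) (besov_block f n) k) 'X^k <=
        \sum_(k < 4 * 2 ^ n) 2 * M n.
      apply: ler_sum => k _; rewrite /F -[X in _ <= X]mulr1.
      by apply: ler_pM; rewrite ?disk_norm_horner_ge0.
    have h2 : \sum_(k < 4 * 2 ^ n) F 'X^k (ramp_poly (2 ^ n) (besov_block f n) k) <=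
        \sum_(k < 4 * 2 ^ n) 2 * M n.
      apply: ler_sum => k _; rewrite /F -[X in _ <= X]mul1r.
      by apply: ler_pM; rewrite ?disk_norm_horner_ge0.
    apply: (le_trans (lerD h1 h2)).
    have -> : \sum_(k < 4 * 2 ^ n) 2 * M n = 4 * 2 ^+ n * (2 * M n).
      by rewrite -natrX -natrM [RHS]mulr_natl sumr_const card_ord.
    by rewrite le_eqVlt; apply/orP; left; apply/eqP; ring.
  by rewrite -mulr_sumr ler_pM2l.
apply: (@le_lt_trans _ _ (c + 16 * C)%:E); last exact: ltry.
apply: lime_le; first by apply: is_cvg_nneseries => m _ _; rewrite lee_fin F0.
near=> K; rewrite sumEFin lee_fin.
have le : (K <= 2 ^ (K + 3))%N.
  by rewrite (leq_trans (leq_addr 3 K)) // ltnW // ltn_expl.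
apply: le_trans (partial K); rewrite (big_cat_nat _ le) //= lerDl.
by apply: sumr_ge0 => m _; exact: F0.
Unshelve. all: by end_near. Qed.

End TensorRepresentation.

(** * The tensor series converges to the divided difference, also on the diagonal *)

Section DividedDifference.
Variable R : realType.
Variable f : circle R -> R[i].
Hypothesis hf : besov_plus 1 +oo%E 1%E f.

Let phi := analytic_extension f.
Let norms m : R :=
  disk_norm (horner (tensor f m).1) * disk_norm (horner (tensor f m).2).

Lemma norms_ge0 m : 0 <= norms m.
Proof. by rewrite mulr_ge0 // disk_norm_horner_ge0. Qed.

Lemma horner_disk_norm (p : {poly R[i]}) z :
  closed_disk R z -> `|p.[z]| <= (disk_norm (horner p))%:C.
Proof. by apply: disk_norm_bound; have [] := disk_algebra_poly p. Qed.

Lemma tensor_norm_le m z w : closed_disk R z -> closed_disk R w ->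
  `|(tensor f m).1.[z] * (tensor f m).2.[w]| <= (norms m)%:C.
Proof.
by move=> Dz Dw; rewrite normrM rmorphM; apply: ler_pM => //; exact: horner_disk_norm.
Qed.

Lemma norms_cvg : cvgn (series norms).
Proof. by apply: nnseries_is_cvg (tensor_summable hf); exact: norms_ge0. Qed.

Lemma tensor_partial_sum J z w :
  (z - w) * \sum_(0 <= m < 2 ^ (J + 3)) (tensor f m).1.[z] * (tensor f m).2.[w] =
  (besov_partial f J).[z] - (besov_partial f J).[w].
Proof.
pose g j k : R[i]^o := z ^+ j * w ^+ k.
have := bilinear_eval_tensor f g J.
rewrite /telescope_eval => e.
rewrite !(horner_coef (besov_partial f J)) -sumrB.
rewrite (eq_bigr (fun m : 'I_(size (besov_partial f J)) =>
  (besov_partial f J)`_m *: (g m 0%N - g 0%N m))); last first.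
  by move=> m _; rewrite /g !expr0 mulr1 mul1r scalerBr.
rewrite -e mulr_sumr; apply: eq_bigr => m _; rewrite /bilinear_eval.
set p := (tensor f m).1; set q := (tensor f m).2.
rewrite (horner_coef p) (horner_coef q) mulr_suml mulr_sumr; apply: eq_bigr => j _.
rewrite mulr_sumr mulr_sumr; apply: eq_bigr => k _.
rewrite /g /GRing.scale /= !exprS; ring.
Qed.

(** Off the diagonal the product identity determines l. On it that identity reads 0 = 0, and the
    tail bound, uniform in z and w, identifies l with the derivative. *)
Lemma tensor_limit z w : closed_disk R z -> closed_disk R w ->
  exists l : R[i],
    [/\ series (fun m => (tensor f m).1.[z] * (tensor f m).2.[w]) @ \oo --> l,
        (z - w) * l = phi z - phi w &
        forall N (e : R), (forall N', \sum_(N <= m < N') norms m <= e) ->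
          `|\sum_(0 <= m < N) (tensor f m).1.[z] * (tensor f m).2.[w] - l| <=
            e%:C].
Proof.
move=> Dz Dw.
have [l cl] : exists l : R[i],
    series (fun m => (tensor f m).1.[z] * (tensor f m).2.[w]) @ \oo --> l.
  apply: normC_series_cvg norms_cvg => m; exact: tensor_norm_le.
have clP (e : R[i]) : 0 < e -> \forall N \near \oo,
    `|l - \sum_(0 <= m < N) (tensor f m).1.[z] * (tensor f m).2.[w]| <= e.
  by move=> e0; move/cvgrPdist_le : cl; exact.
exists l; split => //.
- apply/eqP; rewrite -subr_eq0 -normr_le0; apply/ler_addgt0Pr => e e0.
  rewrite add0r.
  have p0 : 0 < 2 + `|z - w| by rewrite ltr_pwDl.
  have [d d0 dE] : exists2 d : R[i], 0 < d & d * (2 + `|z - w|) = e.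
    by exists (e / (2 + `|z - w|)); rewrite ?divr_gt0 // divfK // gt_eqF.
  have [N _ hN] := clP d d0.
  have ap := analytic_extension_approx hf d0.
  have [J [NJ hJ]] := filter_ex (filterI (nbhs_infty_ge N) ap).
  have {}hN := hN (2 ^ (J + 3))%N (leq_trans NJ (leq_trans (leq_addr 3 J)
     (ltnW (ltn_expl (J + 3) (isT : (1 < 2)%N))))).
  have hz : `|(besov_partial f J).[z] - phi z| <= d by exact: hJ.
  have hw : `|(besov_partial f J).[w] - phi w| <= d by exact: hJ.
  rewrite -dE mulrDr; have eS := tensor_partial_sum J z w.
  move: hN hz hw eS; set S := (X in l - X).
  set a := (besov_partial f J).[z]; set b := (besov_partial f J).[w].
  move: (phi z) (phi w) => u v hN hz hw eS.
  have -> : (z - w) * l - (u - v) = (a - u) - (b - v) + (z - w) * (l - S).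
    by rewrite mulrBr eS; ring.
  apply: (le_trans (ler_normD _ _)); apply: lerD; last first.
    by rewrite normrM mulrC ler_wpM2r.
  have -> : d * 2 = d + d by ring.
  by apply: (le_trans (ler_normB _ _)); exact: lerD.
- move=> N e tail; apply/ler_addgt0Pr => d d0.
  have [N' [NN' hN']] := filter_ex (filterI (nbhs_infty_ge N) (clP d d0)).
  apply: (le_trans (ler_distD (\sum_(0 <= m < N')
    (tensor f m).1.[z] * (tensor f m).2.[w]) _ _)).
  apply: lerD; last by rewrite distrC.
  rewrite distrC (big_cat_nat _ NN') //= addrAC subrr add0r.
  apply: (le_trans (ler_norm_sum _ _ _)).
  apply: (@le_trans _ _ (\sum_(N <= m < N') (norms m)%:C)).
    by apply: ler_sum => m _; exact: tensor_norm_le.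
  by rewrite -rmorph_sum lecR.
Qed.

(** The limit on the diagonal makes sense because the disk accumulates radially at z: s = d / (1 +
    d) is below both 1 and d, so (1 - s) z is in the disk, near z and distinct from it. *)
Lemma punctured_disk_proper (z : circle R) :
  ProperFilter (within (closed_disk R) (sval z)^').
Proof.
split; last exact: within_filter.
rewrite /within /dnbhs /= => /nbhs_ballP[d /= d0 hd].
have z1 : `|sval z| = 1 := eqP (svalP z).
have p0 : 0 < 1 + d by rewrite addr_gt0.
pose s := d / (1 + d).
have s0 : 0 < s by exact: divr_gt0.
have s1 : s < 1 by rewrite ltr_pdivrMr // mul1r ltrDr.
have sd : s < d by rewrite ltr_pdivrMr // ltr_pMr // ltrDl.
have ns : `|sval z - (1 - s) * sval z| = s.
  have -> : sval z - (1 - s) * sval z = s * sval z by ring.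
  by rewrite normrM z1 mulr1 gtr0_norm.
apply: (hd ((1 - s) * sval z)).
- by rewrite -ball_normE /ball_ /= ns.
- apply/negP => /eqP e; move: ns; rewrite e subrr normr0 => e0.
  by rewrite -e0 ltxx in s0.
- rewrite /closed_disk /= normrM z1 mulr1 gtr0_norm ?subr_gt0 //.
  by rewrite lerBlDr lerDl ltW.
Qed.

Lemma divided_difference_tensor :
  tensor_representation (divided_difference phi)
    (fun m => horner (tensor f m).1) (fun m => horner (tensor f m).2).
Proof.
split => [m|m||z w].
- exact: disk_algebra_poly.
- exact: disk_algebra_poly.
- exact: tensor_summable.
have Dz := circle_closed_disk z; have Dw := circle_closed_disk w.
have [l [cl lE ltail]] := tensor_limit Dz Dw.
suff -> : divided_difference phi z w = l by [].
rewrite /divided_difference; case: eqVneq => [zw|zw]; last first.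
  by rewrite -lE mulrC mulKf // subr_eq0.
rewrite -{}zw in Dw cl lE ltail *.
apply: cvg_lim; first exact: norm_hausdorff.
  exact: punctured_disk_proper.
apply/cvgrPdist_le => e e0.
have eR : e / 3 = (complex.Re (e / 3))%:C.
  by rewrite RRe_real // gtr0_real // divr_gt0.
have e30 : 0 < complex.Re (e / 3) by rewrite -ltcR -eR divr_gt0.
have [N _ tail] := series_tail_le norms_ge0 norms_cvg e30.
have {}tail := tail N (leqnn N).
(* The partial sum with the second variable frozen at z is a polynomial, so it varies by at most e /
   3 near z; the two tails account for the other two thirds. *)
pose P : {poly R[i]} :=
  \sum_(0 <= m < N) (tensor f m).2.[sval z] *: (tensor f m).1.
have PE u : P.[u] =
    \sum_(0 <= m < N) (tensor f m).1.[u] * (tensor f m).2.[sval z].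
  by rewrite /P horner_sum; apply: eq_bigr => m _; rewrite hornerZ mulrC.
have nP : \forall u \near sval z, `|P.[sval z] - P.[u]| <= e / 3.
  by apply: (@near_horner R[i]); rewrite divr_gt0.
apply: filterS nP => u hu uz Du.
have [l' [_ l'E l'tail]] := tensor_limit Du Dz.
have -> : (phi u - phi (sval z)) / (u - sval z) = l'.
  by rewrite -l'E mulrC mulKf // subr_eq0.
have h1 := ltail N _ tail; have h2 := l'tail N _ tail.
rewrite -PE -eR in h1; rewrite -PE -eR in h2.
have -> : l - l' = - (P.[sval z] - l) + (P.[sval z] - P.[u]) + (P.[u] - l') by ring.
have -> : e = e / 3 + e / 3 + e / 3 by field.
apply: (le_trans (ler_normD _ _)); apply: lerD => //.
by apply: (le_trans (ler_normD _ _)); apply: lerD; rewrite ?normrN.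
Qed.

End DividedDifference.

(** * The double operator integral of the divided difference *)

Section Existence.
Context {R : realType}.

Lemma uniform_integral_dist d (X : measurableType d) (H : hilbertType R)
    (E : set X -> {linear H -> H}) u v A B (M : R[i]) x :
  bounded_integral E -> uniform_integral E u A -> uniform_integral E v B ->
  0 < M -> (forall t, `|u t - v t| <= M) -> `|A x - B x| <= 2 * M * `|x|.
Proof.
move=> bE uA vB M0 uv; apply: (@ler_scaled_addgt0 _ _ _ _ 3 x) => // e e0.
have [s [ss su Is]] := uA _ e0.
have sv t : `|s t - v t| <= M + e.
  apply: (le_trans (ler_distD (u t) _ _)); rewrite addrC; exact: lerD.
have h := uniform_integral_rigid x bE vB ss (addr_gt0 M0 e0) sv.
apply: (le_trans (ler_distD (simple_integral E s x) _ _)).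
rewrite distrC; apply: (le_trans (lerD (Is x) h)).
by rewrite le_eqVlt; apply/orP; left; apply/eqP; ring.
Qed.

Variable f : circle R -> R[i].
Hypothesis hf : besov_plus 1 +oo%E 1%E f.
Variable H : hilbertType R.

Lemma disk_calculus_besov (T : {linear H -> H})
    (E : set (circle_borel R) -> {linear H -> H}) :
  semi_spectral_measure_of T E ->
  op_cvg (fun J => poly_calculus (besov_partial f J) T)
    (disk_calculus (analytic_extension f) T).
Proof.
move=> hE; have [K [V [U [F [_ _ _ dil]]]]] := hE.
have bE := dilation_bounded_integral dil.
have ap := analytic_extension_approx hf.
have ul : @uniform_simple_limit R _ (circle_borel R)
    (fun z => analytic_extension f (sval z)).
  move=> e e0; have e20 : 0 < e / 2 by rewrite divr_gt0.
  have [J hJ] := filter_ex (ap _ e20).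
  have [s [ss su _]] := uniform_integral_poly hE (besov_partial f J) e20.
  exists s => // t.
  apply: (le_trans (ler_distD (besov_partial f J).[sval t] _ _)).
  rewrite (splitr e) lerD //; apply: hJ; exact: circle_closed_disk.
have [A uA] := uniform_integral_exists bE ul.
have cA : op_cvg (fun J => poly_calculus (besov_partial f J) T) A.
  move=> e e0; have e20 : 0 < e / 2 by rewrite divr_gt0.
  apply: filterS (ap _ e20) => J hJ x.
  have -> : e = 2 * (e / 2) by rewrite mulrC divfK.
  apply: (uniform_integral_dist _ bE (uniform_integral_poly hE _) uA e20) => t.
  by apply: hJ; exact: circle_closed_disk.
rewrite (@disk_calculus_eq _ _ _ _ hE _ A) //.
exists (besov_partial f); split => //.
by apply/uniform_cvgP => e e0; exact: ap.
Qed.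

Lemma poly_calculus_bilinear (T S : {linear H -> H}) (p q : {poly R[i]}) x :
  poly_calculus p T ((T \- S) (poly_calculus q S x)) =
  bilinear_eval (fun j k => iter j.+1 T (iter k S x) - iter j T (iter k.+1 S x)) p q.
Proof.
have iterD n (A : {linear H -> H}) y z : iter n A (y - z) = iter n A y - iter n A z.
  by elim: n => //= n ->; rewrite linearB.
have iter_sum n (A : {linear H -> H}) m (c : 'I_m -> R[i]) (v : 'I_m -> H) :
    iter n A (\sum_i c i *: v i) = \sum_i c i *: iter n A (v i).
  elim: n => //= n ->; rewrite linear_sum; apply: eq_bigr => i _.
  by rewrite linearZ.
rewrite /poly_calculus /bilinear_eval; apply: eq_bigr => j _.
have -> : (T \- S) (\sum_(i < size q) q`_i *: iter i S x) =
    \sum_(i < size q) q`_i *: (T (iter i S x) - S (iter i S x)).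
  by rewrite linear_sum; apply: eq_bigr => i _; rewrite linearZ.
rewrite iter_sum scaler_sumr; apply: eq_bigr => k _.
by rewrite iterD scalerA -iterSr.
Qed.

Lemma divided_difference_integral (T S : {linear H -> H})
    (E1 E2 : set (circle_borel R) -> {linear H -> H}) (q : R[i]) :
  semi_spectral_measure_of T E1 -> semi_spectral_measure_of S E2 ->
  0 <= q -> (forall x, `|(T \- S) x| <= q * `|x|) ->
  is_double_operator_integral (divided_difference (analytic_extension f))
    E1 (T \- S) E2
    (disk_calculus (analytic_extension f) T \-
     disk_calculus (analytic_extension f) S).
Proof.
move=> h1 h2 q0 Qq.
exists (fun m => horner (tensor f m).1), (fun m => horner (tensor f m).2).
split; first exact: divided_difference_tensor.
have [K1 [V1 [U1 [F1 [_ _ _ dil1]]]]] := h1.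
have [K2 [V2 [U2 [F2 [_ _ _ dil2]]]]] := h2.
have b1 := dilation_bounded_integral dil1.
have b2 := dilation_bounded_integral dil2.
have I1 m := semi_spectral_integral_eq dil1
  (uniform_integral_poly h1 (tensor f m).1).
have I2 m := semi_spectral_integral_eq dil2
  (uniform_integral_poly h2 (tensor f m).2).
pose t m x := poly_calculus (tensor f m).1 T
  ((T \- S) (poly_calculus (tensor f m).2 S x)).
have norms0 := norms_ge0 f.
pose a m := disk_norm (horner (tensor f m).1) * disk_norm (horner (tensor f m).2).
have tle m x : `|t m x| <= 4 * q * (a m)%:C * `|x|.
  have le1 y : `|poly_calculus (tensor f m).1 T y| <=
      2 * (disk_norm (horner (tensor f m).1))%:C * `|y|.
    apply: (uniform_integral_le b1 _ (uniform_integral_poly h1 _)).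
      by rewrite ler0c disk_norm_horner_ge0.
    by move=> z; apply: horner_disk_norm; exact: circle_closed_disk.
  have le2 y : `|poly_calculus (tensor f m).2 S y| <=
      2 * (disk_norm (horner (tensor f m).2))%:C * `|y|.
    apply: (uniform_integral_le b2 _ (uniform_integral_poly h2 _)).
      by rewrite ler0c disk_norm_horner_ge0.
    by move=> z; apply: horner_disk_norm; exact: circle_closed_disk.
  apply: (le_trans (le1 _)).
  have d0 : 0 <= 2 * (disk_norm (horner (tensor f m).1))%:C :> R[i].
    by rewrite mulr_ge0 // ler0c disk_norm_horner_ge0.
  apply: (le_trans (ler_wpM2l d0 (Qq _))).
  apply: (le_trans (ler_wpM2l d0 (ler_wpM2l q0 (le2 _)))).
  by rewrite /a rmorphM /= le_eqVlt; apply/orP; left; apply/eqP; ring.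
have sumE J x : \sum_(0 <= m < 2 ^ (J + 3)) t m x =
    poly_calculus (besov_partial f J) T x - poly_calculus (besov_partial f J) S x.
  rewrite /t; under eq_bigr do rewrite poly_calculus_bilinear.
  rewrite (bilinear_eval_tensor f (fun j k => iter j T (iter k S x))).
  rewrite /telescope_eval /poly_calculus -sumrB; apply: eq_bigr => m _.
  by rewrite scalerBr.
move=> e e0.
(* Error budget: 4 q d for a tail of the tensor series and d for each of the two disk calculi. *)
have p0 : 0 < 2 + 4 * q by rewrite ltr_pwDl // mulr_ge0.
have [d d0 dE] : exists2 d : R[i], 0 < d & (2 + 4 * q) * d = e.
  by exists (e / (2 + 4 * q)); rewrite ?divr_gt0 // mulrC divfK // gt_eqF.
have dR : d = (complex.Re d)%:C by rewrite RRe_real // gtr0_real.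
have dR0 : 0 < complex.Re d by rewrite -ltcR -dR.
apply: filterS (series_tail_le norms0 (norms_cvg hf) dR0) => N tail x.
under eq_bigr do rewrite I1 I2.
rewrite -/(t _ x).
(* The telescoping identity evaluates the series only at the ends 2^(J+3) of complete blocks; a
   general N is compared with a later such end through the tail. *)
have [J [NJ [hT hS]]] := filter_ex (filterI (nbhs_infty_ge N)
  (filterI (disk_calculus_besov h1 d0) (disk_calculus_besov h2 d0))).
have NN' : (N <= 2 ^ (J + 3))%N.
  exact: leq_trans NJ (leq_trans (leq_addr 3 J) (ltnW (ltn_expl _ _))).
apply: (le_trans (ler_distD (\sum_(0 <= m < 2 ^ (J + 3)) t m x) _ _)).
have -> : e * `|x| = 4 * q * d * `|x| + (d * `|x| + d * `|x|) by rewrite -dE; ring.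
apply: lerD.
  rewrite distrC (big_cat_nat _ NN') //= addrAC subrr add0r.
  apply: (le_trans (ler_norm_sum _ _ _)).
  apply: (@le_trans _ _ (\sum_(N <= m < 2 ^ (J + 3)) 4 * q * `|x| * (a m)%:C)).
    by apply: ler_sum => m _; rewrite mulrAC; exact: tle.
  rewrite -mulr_sumr (_ : 4 * q * d * `|x| = 4 * q * `|x| * d); last by ring.
  by rewrite ler_wpM2l ?mulr_ge0 // dR -rmorph_sum lecR; exact: tail.
rewrite sumE /= opprD opprK addrACA [- _ + _]addrC.
apply: (le_trans (ler_normD _ _)); apply: lerD; first exact: hT.
by rewrite distrC; exact: hS.
Qed.

End Existence.

Theorem theorem4p1 (R : realType) (f : circle R -> R[i])
    (hf : besov_plus 1 +oo%E 1%E f)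
    (H : hilbertType R) (T S : {linear H -> H})
    (hT : contraction_op T) (hS : contraction_op S)
    (ET ES : set (circle_borel R) -> {linear H -> H})
    (hET : semi_spectral_measure_of T ET)
    (hES : semi_spectral_measure_of S ES) :
  let phi := analytic_extension f in
  disk_calculus phi T \- disk_calculus phi S =
  double_operator_integral (divided_difference phi) ET (T \- S) ES.
Proof.
move=> phi.
have Qq x : `|(T \- S) x| <= 2 * `|x|.
  rewrite /= mulr_natl mulr2n; apply: (le_trans (ler_normB _ _)).
  by apply: lerD; [exact: hT|exact: hS].
have q0 : 0 <= 2 :> R[i] by [].
have hI := divided_difference_integral hf hET hES q0 Qq.
by rewrite (double_operator_integral_eq hET hES q0 Qq hI).
Qed.
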